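(* (Liveness.) Consider an execution of the DRL transition system in which every actor, after performing an Idle, Info, or Release event, eventually (later in the execution) takes a snapshot. Then every actor that is terminated at some time is eventually part of a finalized set of snapshots, i.e.\ there is a finalized set of snapshots $Q$ taken in the execution with that actor in $\mathrm{dom}(Q)$.
   Context: DRL transition system. Refobs are triples $x: A\to B$ (token $x$, owner $A$, target $B$). Facts: $\mathrm{Created}(x)$, $\mathrm{Released}(x)$, $\mathrm{CreatedUsing}(x,y)$, $\mathrm{Activated}(x)$, $\mathrm{Unreleased}(x)$, $\mathrm{SentCount}(x,n)$, $\mathrm{RecvCount}(x,n)$. A knowledge set $\Phi$ is a finite set of facts; $\Phi\vdash\varphi$ means derivability in first-order logic plus: if no $\mathrm{SentCount}(x,n)\in\Phi$ then $\Phi\vdash\mathrm{SentCount}(x,0)$; likewise for $\mathrm{RecvCount}$; $\Phi\vdash\mathrm{Created}(x)\wedge\neg\mathrm{Released}(x)$ gives $\Phi\vdash\mathrm{Unreleased}(x)$; $\Phi\vdash\mathrm{CreatedUsing}(x,y)$ gives $\Phi\vdash\mathrm{Created}(y)$. $\mathrm{IncSent}/\mathrm{IncRecv}(x,\Phi)$ increment (or create with value $1$) the corresponding count. Messages: $\mathrm{App}(x,R)$, $\mathrm{Info}(y,z,B)$, $\mathrm{Release}(x,n)$. A configuration $(\alpha,\mu,\rho,\chi)$: $\alpha$ maps internal actors to busy $[\Phi]$ or idle $(\Phi)$ states; $\mu$ gives undelivered messages of each actor; receptionists $\rho\subseteq\mathrm{dom}(\alpha)$; external actors $\chi$. Initial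 configuration: one busy actor $A$ with $\{\mathrm{Activated}(x:A\to E),\mathrm{Created}(y:A\to A),\mathrm{Activated}(y:A\to A)\}$, no messages, $\rho=\emptyset$, $\chi=\{E\}$. Events: Spawn$(x,A,B)$: busy $A$, fresh $x,y,B$; $A$ adds $\mathrm{Activated}(x:A\to B)$; new busy $B$ with $\{\mathrm{Created}(x:A\to B),\mathrm{Created}(y:B\to B),\mathrm{Activated}(y:B\to B)\}$. Send$(x,\vec y,\vec z,A,B,\vec C)$: busy $A$ with $\Phi\vdash\mathrm{Activated}(x:A\to B)$ and $\Phi\vdash\mathrm{Activated}(y_i:A\to C_i)$, fresh $z_i$; $A$'s set becomes $\mathrm{IncSent}(x,\Phi)\cup\{\mathrm{CreatedUsing}(y_i,z_i)\}$; $\mathrm{App}(x,\{z_i:B\to C_i\})$ sent to $B$. Receive$(x,B,R)$: idle $B$ consumes $\mathrm{App}(x,R)$, becomes busy with $\mathrm{IncRecv}(x,\Phi)\cup\{\mathrm{Activated}(z):z\in R\}$. Idle$(A)$: busy $A$ becomes idle. SendInfo$(y,z,A,B,C)$: busy $A$ containing $\mathrm{CreatedUsing}(y:A\to C,z:B\to C)$ removes it, increments send count of $y$, sends $\mathrm{Info}(y,z,B)$ to $C$. Info$(y,z,B,C)$: idle $C$ consumes it, stays idle with $\mathrm{IncRecv}(y,\Phi)\cup\{\mathrm{Created}(z:B\to C)\}$. SendRelease$(x,A,B)$: busy $A$ with set $\Phi\cup\{\mathrm{Activated}(x:A\to B),\mathrm{SentCount}(x,n)\}$, no $\mathrm{CreatedUsing}(x,y)\in\Phi$: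 set becomes $\Phi$; sends $\mathrm{Release}(x,n)$ to $B$. Release$(x,A,B)$: idle $B$ consumes $\mathrm{Release}(x,n)$ only if $\Phi\vdash\mathrm{RecvCount}(x,n)$; adds $\mathrm{Released}(x)$; $x$ is released. Compaction$(x,B,C)$: idle $C$ containing $\mathrm{Created}(x:B\to C),\mathrm{Released}(x)$ removes them and any $\mathrm{RecvCount}(x,n)$. Snapshot$(A,\Phi)$: idle $A$; no change; records $\Phi$ as a snapshot of $A$ (the actor ''takes a snapshot''). In$(x,A,R)$: $A\in\rho$ receives from outside $\mathrm{App}(x,R)$ with fresh refobs owned by $A$ whose internal targets lie in $\rho$; external targets join $\chi$. Out$(x,B,R)$: $B\in\chi$ consumes $\mathrm{App}(x,R)$; internal targets of $R$ join $\rho$. ReleaseOut/InfoOut: Release/Info messages to external actors are dropped. Times index the configurations $\kappa_t$ of an execution. An actor is terminated at time $t$ if it is idle in $\kappa_t$ and no finite sequence of events from $\kappa_t$ leads to a configuration where it has an undelivered message. A set of snapshots $Q$ maps (internal) actors to knowledge sets recorded by their Snapshot events in the execution (one per actor in its domain). For a refob $x:A\to B$: $Q\vdash\mathrm{Activated}(x)$, $Q\vdash\mathrm{SentCount}(x,n)$, $Q\vdash\mathrm{CreatedUsing}(x,y)$ mean $A\in\mathrm{dom}(Q)$ and $Q(A)$ derives the fact; $Q\vdash\mathrm{Created}(x)$, $Q\vdash\mathrm{Released}(x)$, $Q\vdash\mathrm{RecvCount}(x,n)$ mean $B\in\mathrm{dom}(Q)$ and $Q(B)$ derives the fact. $Q\vdash\mathrm{Chain}(x:A\to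 B)$ iff there are refobs $x_1:A_1\to B,\dots,x_n:A_n\to B$ with $Q\vdash\mathrm{Created}(x_1)$, $Q\not\vdash\mathrm{Released}(x_1)$, for all $i<n$ $Q\vdash\mathrm{CreatedUsing}(x_i,x_{i+1})$ and $Q\not\vdash\mathrm{Released}(x_{i+1})$, and $A_n=A$, $x_n=x$. $Q\vdash\mathrm{Relevant}(x)$ iff for some $n$, $Q\vdash\mathrm{Activated}(x)$, $Q\vdash\mathrm{SentCount}(x,n)$, $Q\vdash\mathrm{RecvCount}(x,n)$. $Q$ is finalized if for all $B\in\mathrm{dom}(Q)$ and all $x:A\to B$, $Q\vdash\mathrm{Chain}(x)$ implies $A\in\mathrm{dom}(Q)$ and $Q\vdash\mathrm{Relevant}(x)$.
   Formalization: Added assumption: the delivery of an Info or Release message is not enabled forever without occurring. Without it the claim fails: if a Release to A stays undelivered, A's snapshots still show an unreleased refob from C that no snapshot of C has as activated. *)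

(* Defs.v *)
From HB Require Import structures.
From mathcomp Require Import all_boot.
From mathcomp Require Import finmap multiset.

Set Implicit Arguments.
Unset Strict Implicit.
Unset Printing Implicit Defensive.

Local Open Scope fset_scope.
Local Open Scope fmap_scope.
Local Open Scope nat_scope.

Notation actor := nat (only parsing).
Notation token := nat (only parsing).

(* [Refob x A B] is the refob x : A -> B. *)
Record refob := Refob { rtoken : token; owner : actor; target : actor }.

Definition refob_code (x : refob) := (rtoken x, owner x, target x).
Definition refob_decode (c : token * actor * actor) := Refob c.1.1 c.1.2 c.2.
Lemma refob_codeK : cancel refob_code refob_decode. Proof. by case. Qed.
HB.instance Definition _ := Choice.copy refob (can_type refob_codeK).

(** * Facts and knowledge sets *)

Inductive fact :=
| Created of refob
| Released of refob
| CreatedUsing of refob & refob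
| Activated of refob
| Unreleased of refob
| SentCount of refob & nat
| RecvCount of refob & nat.

Definition fact_code (f : fact) : nat * refob * refob * nat :=
  match f with
  | Created x => (0, x, x, 0)
  | Released x => (1, x, x, 0)
  | CreatedUsing x y => (2, x, y, 0)
  | Activated x => (3, x, x, 0)
  | Unreleased x => (4, x, x, 0)
  | SentCount x n => (5, x, x, n)
  | RecvCount x n => (6, x, x, n)
  end.
Definition fact_decode (c : nat * refob * refob * nat) : fact :=
  let: (k, x, y, n) := c in
  match k with
  | 0 => Created x
  | 1 => Released x
  | 2 => CreatedUsing x y
  | 3 => Activated x
  | 4 => Unreleased x
  | 5 => SentCount x n
  | _ => RecvCount x n
  end.
Lemma fact_codeK : cancel fact_code fact_decode. Proof. by case. Qed.
HB.instance Definition _ := Choice.copy fact (can_type fact_codeK).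

Definition knowledge := {fset fact}.

(* Derivability of atomic facts.  A knowledge set consists of ground atoms, so
   an atom is derivable exactly when it is a member or follows by one of the
   four additional rules; the negation in the rule for [Unreleased] is read as
   non-derivability (no rule derives [Released]). *)
Inductive derives (Phi : knowledge) : fact -> Prop :=
| derives_mem f : f \in Phi -> derives Phi f
| derives_sent0 x :
    (forall n, SentCount x n \notin Phi) -> derives Phi (SentCount x 0)
| derives_recv0 x :
    (forall n, RecvCount x n \notin Phi) -> derives Phi (RecvCount x 0)
| derives_unreleased x :
    derives Phi (Created x) -> Released x \notin Phi ->
    derives Phi (Unreleased x)
| derives_created x y :
    derives Phi (CreatedUsing x y) -> derives Phi (Created y).

Definition is_sent (x : refob) (f : fact) : bool :=
  if f is SentCount y _ then y == x else false.
Definition is_recv (x : refob) (f : fact) : bool :=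
  if f is RecvCount y _ then y == x else false.

Definition count_succ (f : fact) : fact :=
  match f with
  | SentCount x n => SentCount x n.+1
  | RecvCount x n => RecvCount x n.+1
  | _ => f
  end.

Definition IncSent (x : refob) (Phi : knowledge) : knowledge :=
  if has (is_sent x) (enum_fset Phi)
  then [fset (if is_sent x f then count_succ f else f) | f in Phi]
  else SentCount x 1 |` Phi.

Definition IncRecv (x : refob) (Phi : knowledge) : knowledge :=
  if has (is_recv x) (enum_fset Phi)
  then [fset (if is_recv x f then count_succ f else f) | f in Phi]
  else RecvCount x 1 |` Phi.

(** * Messages and configurations *)

Inductive msg :=
| AppMsg of refob & {fset refob}
| InfoMsg of refob & refob & actor
| ReleaseMsg of refob & nat.

Definition msg_code (m : msg) :
    refob * {fset refob} + (refob * refob * actor + refob * nat) :=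
  match m with
  | AppMsg x R => inl (x, R)
  | InfoMsg y z B => inr (inl (y, z, B))
  | ReleaseMsg x n => inr (inr (x, n))
  end.
Definition msg_decode
    (c : refob * {fset refob} + (refob * refob * actor + refob * nat)) : msg :=
  match c with
  | inl (x, R) => AppMsg x R
  | inr (inl (y, z, B)) => InfoMsg y z B
  | inr (inr (x, n)) => ReleaseMsg x n
  end.
Lemma msg_codeK : cancel msg_code msg_decode. Proof. by case. Qed.
HB.instance Definition _ := Choice.copy msg (can_type msg_codeK).

Inductive astate := Busy of knowledge | Idle of knowledge.

Definition knowledge_of (s : astate) : knowledge :=
  match s with Busy Phi => Phi | Idle Phi => Phi end.

Record config := Config {
  internal : {fmap actor -> astate};
  undelivered : actor -> multiset msg;
  receptionists : {fset actor};
  externals : {fset actor} }.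

Definition send (mu : actor -> multiset msg) (B : actor) (m : msg) :
  actor -> multiset msg := [eta mu with B |-> (mu B `+` [mset m])%mset].
Definition consume (mu : actor -> multiset msg) (B : actor) (m : msg) :
  actor -> multiset msg := [eta mu with B |-> (mu B `\` [mset m])%mset].

Definition fact_refobs (f : fact) : seq refob :=
  match f with
  | CreatedUsing x y => [:: x; y]
  | Created x | Released x | Activated x | Unreleased x
  | SentCount x _ | RecvCount x _ => [:: x]
  end.
Definition msg_refobs (m : msg) : seq refob :=
  match m with
  | AppMsg x R => x :: enum_fset R
  | InfoMsg y z _ => [:: y; z]
  | ReleaseMsg x _ => [:: x]
  end.

Definition occurs (k : config) (r : refob) : Prop :=
  (exists A s f, [/\ (internal k).[? A] = Some s, f \in knowledge_of s
                   & r \in fact_refobs f]) \/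
  (exists A m, m \in undelivered k A /\ r \in msg_refobs m).

Definition fresh_token (k : config) (x : token) : Prop :=
  forall r, occurs k r -> rtoken r <> x.

Definition fresh_actor (k : config) (B : actor) : Prop :=
  [/\ B \notin domf (internal k), B \notin externals k
    & forall r, occurs k r -> owner r <> B /\ target r <> B].

Definition initial (k : config) : Prop :=
  exists (A E : actor) (x y : token),
    [/\ A <> E, x <> y &
      k = Config
        [fmap].[A <- Busy [fset Activated (Refob x A E);
                                Created (Refob y A A);
                                Activated (Refob y A A)]]
        (fun _ => mset0) fset0 [fset E]].

(** * Events and transitions *)

(* In [EvSend x w A B] the list [w] consists of the triples (y_i, z_i, C_i). *)
Inductive event :=
| EvSpawn of token & actor & actor
| EvSend of token & seq (token * token * actor) & actor & actor
| EvReceive of refob & actor & {fset refob}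
| EvIdle of actor
| EvSendInfo of token & token & actor & actor & actor
| EvInfo of refob & token & actor & actor
| EvSendRelease of token & actor & actor
| EvRelease of token & actor & actor
| EvCompaction of token & actor & actor
| EvSnapshot of actor & knowledge
| EvIn of refob & actor & {fset refob}
| EvOut of refob & actor & {fset refob}
| EvReleaseOut of refob & actor
| EvInfoOut of refob & refob & actor.

Implicit Types (al : {fmap actor -> astate}) (mu : actor -> multiset msg).
Implicit Types (rho chi : {fset actor}) (R : {fset refob}).
Implicit Types (Phi : knowledge).

Inductive step : config -> event -> config -> Prop :=
| step_spawn al mu rho chi Phi x y A B :
    let k := Config al mu rho chi in
    al.[? A] = Some (Busy Phi) ->
    fresh_token k x -> fresh_token k y -> x <> y -> fresh_actor k B ->
    step k (EvSpawn x A B)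
      (Config
         al.[A <- Busy (Activated (Refob x A B) |` Phi)]
           .[B <- Busy [fset Created (Refob x A B);
                             Created (Refob y B B);
                             Activated (Refob y B B)]]
         mu rho chi)
| step_send al mu rho chi Phi x (w : seq (token * token * actor)) A B :
    let k := Config al mu rho chi in
    al.[? A] = Some (Busy Phi) ->
    derives Phi (Activated (Refob x A B)) ->
    (forall y z C, (y, z, C) \in w ->
       derives Phi (Activated (Refob y A C)) /\ fresh_token k z) ->
    uniq [seq p.1.2 | p <- w] ->
    step k (EvSend x w A B)
      (Config
         al.[A <- Busy (IncSent (Refob x A B) Phi `|`
                        [fset CreatedUsing (Refob p.1.1 A p.2)
                                           (Refob p.1.2 B p.2) | p in w])]
         (send mu B (AppMsg (Refob x A B) [fset Refob p.1.2 B p.2 | p in w]))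
         rho chi)
| step_receive al mu rho chi Phi x B R :
    al.[? B] = Some (Idle Phi) ->
    AppMsg x R \in mu B ->
    step (Config al mu rho chi) (EvReceive x B R)
      (Config al.[B <- Busy (IncRecv x Phi `|` [fset Activated z | z in R])]
         (consume mu B (AppMsg x R)) rho chi)
| step_idle al mu rho chi Phi A :
    al.[? A] = Some (Busy Phi) ->
    step (Config al mu rho chi) (EvIdle A)
      (Config al.[A <- Idle Phi] mu rho chi)
| step_send_info al mu rho chi Phi y z A B C :
    al.[? A] = Some (Busy Phi) ->
    CreatedUsing (Refob y A C) (Refob z B C) \in Phi ->
    step (Config al mu rho chi) (EvSendInfo y z A B C)
      (Config
         al.[A <- Busy (IncSent (Refob y A C)
                          (Phi `\ CreatedUsing (Refob y A C) (Refob z B C)))]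
         (send mu C (InfoMsg (Refob y A C) (Refob z B C) B)) rho chi)
| step_info al mu rho chi Phi y z B C :
    al.[? C] = Some (Idle Phi) ->
    InfoMsg y (Refob z B C) B \in mu C ->
    step (Config al mu rho chi) (EvInfo y z B C)
      (Config al.[C <- Idle (Created (Refob z B C) |` IncRecv y Phi)]
         (consume mu C (InfoMsg y (Refob z B C) B)) rho chi)
| step_send_release al mu rho chi Phi x n A B :
    al.[? A] = Some (Busy Phi) ->
    derives Phi (Activated (Refob x A B)) ->
    derives Phi (SentCount (Refob x A B) n) ->
    (forall y, CreatedUsing (Refob x A B) y \notin Phi) ->
    step (Config al mu rho chi) (EvSendRelease x A B)
      (Config
         al.[A <- Busy (Phi `\` [fset Activated (Refob x A B);
                                      SentCount (Refob x A B) n])]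
         (send mu B (ReleaseMsg (Refob x A B) n)) rho chi)
| step_release al mu rho chi Phi x n A B :
    al.[? B] = Some (Idle Phi) ->
    ReleaseMsg (Refob x A B) n \in mu B ->
    derives Phi (RecvCount (Refob x A B) n) ->
    step (Config al mu rho chi) (EvRelease x A B)
      (Config al.[B <- Idle (Released (Refob x A B) |` Phi)]
         (consume mu B (ReleaseMsg (Refob x A B) n)) rho chi)
| step_compaction al mu rho chi Phi x B C :
    al.[? C] = Some (Idle Phi) ->
    Created (Refob x B C) \in Phi -> Released (Refob x B C) \in Phi ->
    step (Config al mu rho chi) (EvCompaction x B C)
      (Config
         al.[C <- Idle [fset f in Phi |
                          [&& f != Created (Refob x B C),
                              f != Released (Refob x B C)
                            & ~~ is_recv (Refob x B C) f]]]
         mu rho chi)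
| step_snapshot al mu rho chi Phi A :
    al.[? A] = Some (Idle Phi) ->
    step (Config al mu rho chi) (EvSnapshot A Phi) (Config al mu rho chi)
(* The refob [x] along which the message arrives is held outside the system. *)
| step_in al mu rho chi x A R :
    let k := Config al mu rho chi in
    A \in rho ->
    target x = A -> owner x \notin domf al ->
    (forall r, r \in R -> [/\ owner r = A, fresh_token k (rtoken r),
                              rtoken r <> rtoken x
                            & target r \in domf al -> target r \in rho]) ->
    {in R &, injective rtoken} ->
    step k (EvIn x A R)
      (Config al (send mu A (AppMsg x R)) rho
         (chi `|` ([fset target r | r in R] `\` domf al)))
| step_out al mu rho chi x B R :
    B \in chi ->
    AppMsg x R \in mu B ->
    step (Config al mu rho chi) (EvOut x B R)
      (Config al (consume mu B (AppMsg x R))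
         (rho `|` ([fset target r | r in R] `&` domf al)) chi)
| step_release_out al mu rho chi x n B :
    B \in chi ->
    ReleaseMsg x n \in mu B ->
    step (Config al mu rho chi) (EvReleaseOut x B)
      (Config al (consume mu B (ReleaseMsg x n)) rho chi)
| step_info_out al mu rho chi y z A B :
    B \in chi ->
    InfoMsg y z A \in mu B ->
    step (Config al mu rho chi) (EvInfoOut y z B)
      (Config al (consume mu B (InfoMsg y z A)) rho chi).

Fixpoint steps (k : config) (s : seq event) (k' : config) : Prop :=
  if s is e :: s' then exists2 k1, step k e k1 & steps k1 s' k' else k = k'.

(** * Executions *)

(* [event_at e t] leads from [conf_at e t] to [conf_at e t.+1].  A finite
   execution is padded with [None]; its last configuration is then repeated. *)
Record execution := Execution {
  conf_at : nat -> config;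
  event_at : nat -> option event }.

Definition is_execution (e : execution) : Prop :=
  initial (conf_at e 0) /\
  forall t, match event_at e t with
            | Some ev => step (conf_at e t) ev (conf_at e t.+1)
            | None => conf_at e t.+1 = conf_at e t /\ event_at e t.+1 = None
            end.

Definition calls_for_snapshot (A : actor) (ev : event) : Prop :=
  match ev with
  | EvIdle B => B = A
  | EvInfo _ _ _ C => C = A
  | EvRelease _ _ B => B = A
  | _ => False
  end.

Definition eventually_snapshots (e : execution) : Prop :=
  forall A t ev, event_at e t = Some ev -> calls_for_snapshot A ev ->
    exists t' Phi, t < t' /\ event_at e t' = Some (EvSnapshot A Phi).

Definition is_control_delivery (ev : event) : bool :=
  match ev with EvInfo _ _ _ _ | EvRelease _ _ _ => true | _ => false end.

Definition enabled (k : config) (ev : event) : Prop := exists k', step k ev k'.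

(* Eventual delivery of Info and Release messages, as weak fairness: the
   delivery of such a message is not enabled forever without taking place.
   This is implied by the guarantee that every message sent is eventually
   delivered.  Without it liveness fails: an actor C spawns A and releases it
   before ever taking a snapshot, A spawns B, all three become idle, and the
   Release message to A stays in transit.  Then B is terminated, but in every
   snapshot A still has an unreleased refob from C, which no snapshot of C
   reports as activated. *)
Definition eventually_delivers_control (e : execution) : Prop :=
  forall t ev, is_control_delivery ev ->
    (forall t', t <= t' -> enabled (conf_at e t') ev) ->
    exists2 t', t <= t' & event_at e t' = Some ev.

Definition terminated (e : execution) (t : nat) (A : actor) : Prop :=
  (exists Phi, (internal (conf_at e t)).[? A] = Some (Idle Phi)) /\
  forall s k, steps (conf_at e t) s k -> undelivered k A = mset0.

(** * Sets of snapshots *)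

Definition snapshots := {fmap actor -> knowledge}.

Definition taken_in (e : execution) (Q : snapshots) : Prop :=
  forall A Phi, Q.[? A] = Some Phi ->
    exists t, event_at e t = Some (EvSnapshot A Phi).

Definition fact_holder (f : fact) : actor :=
  match f with
  | Activated x | SentCount x _ | CreatedUsing x _ => owner x
  | Created x | Released x | RecvCount x _ | Unreleased x => target x
  end.

Definition Qderives (Q : snapshots) (f : fact) : Prop :=
  exists2 Phi, Q.[? fact_holder f] = Some Phi & derives Phi f.

(* The refobs of the chain are [c 0], ..., [c n]. *)
Definition Chain (Q : snapshots) (x : refob) : Prop :=
  exists (n : nat) (c : nat -> refob),
    [/\ forall i, i <= n -> target (c i) = target x,
        Qderives Q (Created (c 0)) /\ ~ Qderives Q (Released (c 0)),
        forall i, i < n -> Qderives Q (CreatedUsing (c i) (c i.+1)) /\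
                           ~ Qderives Q (Released (c i.+1))
      & c n = x].

Definition Relevant (Q : snapshots) (x : refob) : Prop :=
  exists n, [/\ Qderives Q (Activated x), Qderives Q (SentCount x n)
              & Qderives Q (RecvCount x n)].

Definition finalized (Q : snapshots) : Prop :=
  forall x : refob, target x \in domf Q -> Chain Q x ->
    owner x \in domf Q /\ Relevant Q x.

(* Main.v *)
Require Import Defs.
From mathcomp Require Import all_boot finmap multiset zify boolp.

(** Proof idea.  Call an actor quiet if it is idle in every reachable
    configuration; a terminated actor is quiet, and so is every owner of an
    activated refob to a quiet actor, since otherwise it could send an
    application message.  No message is ever sent to a quiet actor, so by
    fairness its mailbox eventually stays empty.  [Q] collects, for every actor
    quiet at time [t], a snapshot taken after its last Idle, Info or Release
    event; up to compactions it is the actor's knowledge at any later time [T].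

    [Q] is finalized by invariants on the life cycle of a refob [x]: it is in
    at most one of the stages pending in an application message, activated,
    released by its owner, released at its target; and while its creation is
    still recorded somewhere it is in one of them, unless it is held outside
    and its target is a receptionist.  When the target is quiet with empty
    mailbox and has not recorded a release, only "activated" remains; then the
    send and receive counts of [x] differ by the number of messages in transit,
    which is zero.

    Tokens may be reused once no trace of them is left, so the invariants speak
    only about the current configuration, never about the history. *)

Set Implicit Arguments.
Unset Strict Implicit.
Unset Printing Implicit Defensive.

Local Open Scope fset_scope.
Local Open Scope fmap_scope.
Local Open Scope nat_scope.

Implicit Types (al : {fmap actor -> astate}) (mu : actor -> multiset msg).
Implicit Types (rho chi : {fset actor}) (R : {fset refob}).
Implicit Types (Phi : knowledge) (f : fact) (x y z : refob) (k : config).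

(** * Counting messages in mailboxes *)

Definition fset_memE (K : choiceType) :=
  (@in_fset0 K, @in_fset1 K, @in_fset1U K, @in_fsetU K).

Lemma count_mset1D (T : choiceType) (p : pred T) (a : T) (M : multiset T) :
  count p ([mset a] `+` M)%mset = p a + count p M.
Proof.
(* A multiset is counted through an enumeration, which sums of multisets respect only up to
   permutation. *)
rewrite -[RHS]/(count p (a :: M)); apply/permP.
rewrite -[in X in perm_eq X _](seq_mset_id M) -mset_cons.
exact: perm_eq_seq_mset.
Qed.

Lemma count_send p mu B m C :
  count p (send mu B m C) = ((C == B) && p m) + count p (mu C).
Proof.
rewrite /send /=; case: eqP => [->|//].
by rewrite msetDC count_mset1D.
Qed.

Lemma consumeK mu B m : m \in mu B ->
  mu B = ([mset m] `+` consume mu B m B)%mset.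
Proof. by move=> mB; rewrite /consume /= eqxx msetBDKC // msub1set. Qed.

Lemma count_consume p mu B m C : m \in mu B ->
  count p (mu C) = ((C == B) && p m) + count p (consume mu B m C).
Proof.
move=> mB; case: (eqVneq C B) => [->|nB].
  by rewrite {1}(consumeK mB) count_mset1D.
by rewrite /consume /= (negPf nB).
Qed.

Lemma in_consume mu B m C m' : m' \in consume mu B m C -> m' \in mu C.
Proof.
rewrite /consume /=; case: eqP => [->|//].
by rewrite in_msetB1 => /andP[].
Qed.

Lemma in_send mu B m C m' :
  (m' \in send mu B m C) = ((C == B) && (m' == m)) || (m' \in mu C).
Proof.
rewrite /send /=; case: eqP => [->|//].
by rewrite in_msetD in_mset1 orbC.
Qed.

Lemma mset_has_count (T : choiceType) (p : pred T) (M : multiset T) :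
  reflect (exists2 m, m \in M & p m) (0 < count p M).
Proof. by rewrite -has_count; apply: (iffP hasP). Qed.

(** * Where a fact is held, and what a knowledge set derives *)

Definition kn al A : knowledge := if al.[? A] is Some s then knowledge_of s else fset0.

(** Each fact is looked up at the only actor entitled to record it; [wf_holder] below says that it
    is recorded nowhere else. *)
Definition holds al f := f \in kn al (fact_holder f).

Lemma knE al A s : al.[? A] = Some s -> kn al A = knowledge_of s.
Proof. by rewrite /kn => ->. Qed.

Lemma kn_set al A s C :
  kn al.[A <- s] C = if C == A then knowledge_of s else kn al C.
Proof. by rewrite /kn fnd_set; case: eqP. Qed.

Lemma domf_some al A s : al.[? A] = Some s -> A \in domf al.
Proof. by move=> e; rewrite -fndSome e. Qed.

Lemma domf_set al A s s' : al.[? A] = Some s -> domf al.[A <- s'] = domf al.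
Proof. by move=> /domf_some Ad; rewrite dom_setf mem_fset1U. Qed.

Lemma derives_activated Phi x : derives Phi (Activated x) -> Activated x \in Phi.
Proof. by move=> d; inversion d. Qed.
Lemma derives_using Phi x y : derives Phi (CreatedUsing x y) -> CreatedUsing x y \in Phi.
Proof. by move=> d; inversion d. Qed.
Lemma derives_createdE Phi y : derives Phi (Created y) ->
  Created y \in Phi \/ exists x, CreatedUsing x y \in Phi.
Proof.
move=> d; inversion d; first by left.
by right; exists x; apply: derives_using.
Qed.

Lemma derives_sent_ex Phi x : exists n, derives Phi (SentCount x n).
Proof.
have [[n nP]|no] := pselect (exists n, SentCount x n \in Phi).
  by exists n; apply: derives_mem.
by exists 0; apply: derives_sent0 => n; apply/negP => nP; apply: no; exists n.
Qed.
Lemma derives_recv_ex Phi x : exists n, derives Phi (RecvCount x n).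
Proof.
have [[n nP]|no] := pselect (exists n, RecvCount x n \in Phi).
  by exists n; apply: derives_mem.
by exists 0; apply: derives_recv0 => n; apply/negP => nP; apply: no; exists n.
Qed.

Lemma derives_sent_none Phi x n : (forall m, SentCount x m \notin Phi) ->
  derives Phi (SentCount x n) -> n = 0.
Proof. by move=> no d; inversion d => //; move: (no n); rewrite H. Qed.
Lemma derives_recv_none Phi x n : (forall m, RecvCount x m \notin Phi) ->
  derives Phi (RecvCount x n) -> n = 0.
Proof. by move=> no d; inversion d => //; move: (no n); rewrite H. Qed.

Lemma derives_sent_eq Phi Phi' x n :
  (forall m, (SentCount x m \in Phi) = (SentCount x m \in Phi')) ->
  derives Phi (SentCount x n) -> derives Phi' (SentCount x n).
Proof.
move=> e d; inversion d as [g h|y h| | |]; first by apply: derives_mem; rewrite -e.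
by apply: derives_sent0 => m; rewrite -e.
Qed.
Lemma derives_recv_eq Phi Phi' x n :
  (forall m, (RecvCount x m \in Phi) = (RecvCount x m \in Phi')) ->
  derives Phi (RecvCount x n) -> derives Phi' (RecvCount x n).
Proof.
move=> e d; inversion d as [g h| |y h| |]; first by apply: derives_mem; rewrite -e.
by apply: derives_recv0 => m; rewrite -e.
Qed.

(** * Incrementing send and receive counts *)

Lemma mem_IncSent x Phi f : ~~ is_sent x f -> (f \in IncSent x Phi) = (f \in Phi).
Proof.
move=> nf; rewrite /IncSent; case: ifP => _.
  apply/imfsetP/idP => [[g gP e]|fP]; last by exists f => //; rewrite (negPf nf).
  by move: nf; rewrite {}e; case: ifP => //; case: g gP => //= y n _ ->.
by rewrite in_fset1U; case: eqP nf => // ->; rewrite /= eqxx.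
Qed.

Lemma mem_IncRecv x Phi f : ~~ is_recv x f -> (f \in IncRecv x Phi) = (f \in Phi).
Proof.
move=> nf; rewrite /IncRecv; case: ifP => _.
  apply/imfsetP/idP => [[g gP e]|fP]; last by exists f => //; rewrite (negPf nf).
  by move: nf; rewrite {}e; case: ifP => //; case: g gP => //= y n _ ->.
by rewrite in_fset1U; case: eqP nf => // ->; rewrite /= eqxx.
Qed.

(** If some count of [x] is recorded, all of them are incremented and the default rule applies
    neither before nor after. If none is, the inserted 1 succeeds the default 0. Uniqueness of the
    recorded count is never assumed. *)
Lemma derives_IncSent x Phi y n : derives (IncSent x Phi) (SentCount y n) ->
  exists2 m, derives Phi (SentCount y m) & n = m + (y == x).
Proof.
have [->|nyx] := eqVneq y x; last first.
  move=> d; exists n; last by rewrite addn0.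
  by apply: derives_sent_eq d => m; rewrite mem_IncSent.
rewrite /IncSent; case: ifP => h d; inversion d as [g gP|z no| | |].
- case/imfsetP: gP => f /= fP; case: ifP => [|nf e]; last first.
    by rewrite -e /= eqxx in nf.
  case: f fP => //= y' m yP /eqP e [_ ->]; rewrite e in yP.
  by exists m; [apply: derives_mem | rewrite addn1].
- case/hasP: h => -[] // y' m yP /= /eqP e; rewrite e in yP.
  have /imfsetP[] := no m.+1; exists (SentCount x m) => //=.
  by rewrite eqxx.
- move: gP; rewrite in_fset1U => /orP[/eqP[->]|gP].
    exists 0 => //; apply: derives_sent0 => m; apply/negP => mP.
    by move/negP: h; apply; apply/hasP; exists (SentCount x m) => //=.
  by move/negP: h; case; apply/hasP; exists (SentCount x n) => //=.
- by have := no 1; rewrite in_fset1U eqxx.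
Qed.

Lemma derives_IncRecv x Phi y n : derives (IncRecv x Phi) (RecvCount y n) ->
  exists2 m, derives Phi (RecvCount y m) & n = m + (y == x).
Proof.
have [->|nyx] := eqVneq y x; last first.
  move=> d; exists n; last by rewrite addn0.
  by apply: derives_recv_eq d => m; rewrite mem_IncRecv.
rewrite /IncRecv; case: ifP => h d; inversion d as [g gP| |z no| |].
- case/imfsetP: gP => f /= fP; case: ifP => [|nf e]; last first.
    by rewrite -e /= eqxx in nf.
  case: f fP => //= y' m yP /eqP e [_ ->]; rewrite e in yP.
  by exists m; [apply: derives_mem | rewrite addn1].
- case/hasP: h => -[] // y' m yP /= /eqP e; rewrite e in yP.
  have /imfsetP[] := no m.+1; exists (RecvCount x m) => //=.
  by rewrite eqxx.
- move: gP; rewrite in_fset1U => /orP[/eqP[->]|gP].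
    exists 0 => //; apply: derives_recv0 => m; apply/negP => mP.
    by move/negP: h; apply; apply/hasP; exists (RecvCount x m) => //=.
  by move/negP: h; case; apply/hasP; exists (RecvCount x n) => //=.
- by have := no 1; rewrite in_fset1U eqxx.
Qed.

Lemma in_IncSent x Phi f : f \in IncSent x Phi ->
  f \in Phi \/ exists n, f = SentCount x n.
Proof.
case: (boolP (is_sent x f)) => [|nf]; last by rewrite mem_IncSent //; left.
by case: f => //= y n /eqP -> _; right; exists n.
Qed.

Lemma in_IncRecv x Phi f : f \in IncRecv x Phi ->
  f \in Phi \/ exists n, f = RecvCount x n.
Proof.
case: (boolP (is_recv x f)) => [|nf]; last by rewrite mem_IncRecv //; left.
by case: f => //= y n /eqP -> _; right; exists n.
Qed.

(** * Well-formed configurations *)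

Definition app_carrying x (m : msg) : bool := if m is AppMsg _ R then x \in R else false.
Definition release_of x (m : msg) : bool := if m is ReleaseMsg y _ then y == x else false.
Definition info_about x (m : msg) : bool := if m is InfoMsg _ z _ then z == x else false.
(** The messages whose delivery increments the receive count of [x]. An Info message is counted on
    the refob that was used, not on the one it reports. *)
Definition counted_on x (m : msg) : bool :=
  match m with
  | AppMsg y _ | InfoMsg y _ _ => y == x
  | ReleaseMsg _ _ => false
  end.

Definition msg_ok (B : actor) (m : msg) : Prop :=
  match m with
  | AppMsg x R => target x = B /\ forall r, r \in R -> owner r = B
  | InfoMsg y z A => [/\ target y = B, target z = B & owner z = A]
  | ReleaseMsg x _ => target x = B
  end.

(** Keeping all targets known ensures that the recipient of a message is internal or external, the
    case split of [quiet_pend]. *)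
Definition known_actor k A : bool := (A \in domf (internal k)) || (A \in externals k).

(** Clause [wf_using] persists because SendRelease is blocked while a creation using the refob is
    still unreported. *)
Record wf k : Prop := Wf {
  wf_holder f A : f \in kn (internal k) A ->
    fact_holder f = A /\ {in fact_refobs f, forall r, known_actor k (target r)};
  wf_using y z : holds (internal k) (CreatedUsing y z) ->
    target y = target z /\ holds (internal k) (Activated y);
  wf_msg m B : m \in undelivered k B ->
    msg_ok B m /\ {in msg_refobs m, forall r, known_actor k (target r)};
  wf_disjoint B : B \in externals k -> B \notin domf (internal k);
  wf_rho B : B \in receptionists k -> B \in domf (internal k) }.

Lemma wf_known k A s f r : wf k -> (internal k).[? A] = Some s ->
  f \in knowledge_of s -> r \in fact_refobs f -> known_actor k (target r).
Proof.
by move=> w kA fs; have [|_] := @wf_holder _ w f A; rewrite ?(knE kA) //; apply.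
Qed.

Lemma wf_owner k A s f : wf k -> (internal k).[? A] = Some s ->
  f \in knowledge_of s -> fact_holder f = A.
Proof. by move=> w kA fs; have [|-> _] := @wf_holder _ w f A; rewrite ?(knE kA). Qed.

Lemma wf_using_in k A s y z : wf k -> (internal k).[? A] = Some s ->
  CreatedUsing y z \in knowledge_of s ->
  target y = target z /\ Activated y \in knowledge_of s.
Proof.
move=> w kA h; have /= yA := wf_owner w kA h; have := @wf_using _ w y z.
by rewrite /holds /= yA (knE kA); apply.
Qed.

(** A frame rule: what was already there keeps its properties as long as known actors stay known, so
    only new facts and messages need checking. *)
Lemma wf_update k k' : wf k ->
  (forall A, known_actor k A -> known_actor k' A) ->
  (forall f A, f \in kn (internal k') A -> f \in kn (internal k) A \/
    fact_holder f = A /\ {in fact_refobs f, forall r, known_actor k' (target r)}) ->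
  (forall y z, holds (internal k') (CreatedUsing y z) ->
    target y = target z /\ holds (internal k') (Activated y)) ->
  (forall m B, m \in undelivered k' B -> m \in undelivered k B \/
    msg_ok B m /\ {in msg_refobs m, forall r, known_actor k' (target r)}) ->
  (forall B, B \in externals k' -> B \notin domf (internal k')) ->
  (forall B, B \in receptionists k' -> B \in domf (internal k')) ->
  wf k'.
Proof.
move=> w kk Hf Hc Hm Hd Hr; split=> // [f A /Hf[/(wf_holder w)[h t]|//]|m B /Hm[/(wf_msg w)[h t]|//]].
  by split=> // r /t /kk.
by split=> // r /t /kk.
Qed.

Lemma fact_eqE :
  ((forall x u, (Created x == Created u) = (x == u)) *
   (forall x u, (Released x == Released u) = (x == u)) *
   (forall x u, (Activated x == Activated u) = (x == u)) *
   (forall x y u v,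
      (CreatedUsing x y == CreatedUsing u v) = (x == u) && (y == v)) *
   (forall x u, (Created x == Released u) = false) *
   (forall x u, (Created x == Activated u) = false) *
   (forall x u v, (Created x == CreatedUsing u v) = false) *
   (forall x u, (Released x == Created u) = false) *
   (forall x u, (Released x == Activated u) = false) *
   (forall x u v, (Released x == CreatedUsing u v) = false) *
   (forall x u, (Activated x == Created u) = false) *
   (forall x u, (Activated x == Released u) = false) *
   (forall x u v, (Activated x == CreatedUsing u v) = false) *
   (forall x y u, (CreatedUsing x y == Created u) = false) *
   (forall x y u, (CreatedUsing x y == Released u) = false) *
   (forall x y u, (CreatedUsing x y == Activated u) = false))%type.
Proof.
do 15?[apply: pair] => // x; try by move=> u; apply/eqP/eqP => [[]|->].
by move=> y u v; apply/eqP/andP => [[-> ->]|[/eqP-> /eqP->]].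
Qed.

Definition is_count f : bool :=
  match f with SentCount _ _ | RecvCount _ _ => true | _ => false end.

(** Rewriting the knowledge of one actor affects only facts held there; [del] and [add] describe the
    facts removed and inserted. *)
Lemma holds_set al A s s' (del add : pred fact) f : al.[? A] = Some s ->
  (f \in knowledge_of s') = (f \in knowledge_of s) && ~~ del f || add f ->
  (del f || add f -> fact_holder f = A) ->
  holds al.[A <- s'] f = holds al f && ~~ del f || add f.
Proof.
move=> alA e h; rewrite /holds kn_set; case: eqP => [fA|nA].
  by rewrite e fA (knE alA).
case: (boolP (del f || add f)) => [/h //|].
by rewrite negb_or => /andP[-> /negPf->]; rewrite andbT orbF.
Qed.

Lemma using_setE (A B : actor) (w : seq (token * token * actor)) f :
  f \in [fset CreatedUsing (Refob p.1.1 A p.2) (Refob p.1.2 B p.2) | p in w] ->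
  exists (a b C : nat), (a, b, C) \in w /\ f = CreatedUsing (Refob a A C) (Refob b B C).
Proof. by case/imfsetP => -[[a b] C] /= pw ->; exists a, b, C. Qed.

Lemma app_setE (B : actor) (w : seq (token * token * actor)) r :
  r \in [fset Refob p.1.2 B p.2 | p in w] ->
  exists (a b C : nat), (a, b, C) \in w /\ r = Refob b B C.
Proof. by case/imfsetP => -[[a b] C] /= pw ->; exists a, b, C. Qed.

Lemma wf_actor k mu' s s' A : wf k -> (internal k).[? A] = Some s ->
  (forall f, f \in knowledge_of s' -> f \in knowledge_of s \/
    fact_holder f = A /\ {in fact_refobs f, forall r, known_actor k (target r)}) ->
  (forall y z, CreatedUsing y z \in knowledge_of s' -> owner y = A ->
    target y = target z /\ Activated y \in knowledge_of s') ->
  (forall m B, m \in mu' B -> m \in undelivered k B \/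
    msg_ok B m /\ {in msg_refobs m, forall r, known_actor k (target r)}) ->
  wf (Config (internal k).[A <- s'] mu' (receptionists k) (externals k)).
Proof.
move=> w kA Hf Hc Hm; have dE := domf_set s' kA.
apply: (wf_update w) => [C|f C|y z|m C|C|C]; rewrite /known_actor ?dE //=.
- rewrite kn_set; case: eqP => [->|_]; last by left.
  by rewrite (knE kA); apply: Hf.
- rewrite /holds !kn_set /=; case: eqP => [yA h|_ h]; first exact: Hc.
  exact: (wf_using w h).
- exact: Hm.
- exact: (wf_disjoint w).
- exact: (wf_rho w).
Qed.

(** * Well-formedness is an invariant *)

Lemma wf_initial k : initial k -> wf k.
Proof.
case=> A [E [x [y [AE xy ->]]]].
have kE C : kn (internal (Config [fmap].[A <- Busy [fset Activated (Refob x A E);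
  Created (Refob y A A); Activated (Refob y A A)]] (fun=> mset0) fset0 [fset E])) C
  = if C == A then [fset Activated (Refob x A E);
  Created (Refob y A A); Activated (Refob y A A)] else fset0.
  by rewrite kn_set /kn fnd_fmap0.
split=> //.
- move=> f C; rewrite kE; case: eqP => [->|//]; rewrite !fset_memE -orbA.
  by case/or3P => /eqP ->; split=> // r; rewrite inE => /eqP ->;
    rewrite /known_actor /= ?dom_setf !inE eqxx ?orbT.
- move=> u v; rewrite /holds kE; case: eqP => // _.
  by rewrite !fset_memE !fact_eqE.
- by move=> m B; rewrite in_mset0.
- move=> B; rewrite [externals _]/= [internal _]/= in_fset1 => /eqP->.
  by rewrite dom_setf !inE orbF; apply/eqP => /esym.
Qed.

Lemma wf_step k ev k' : wf k -> step k ev k' -> wf k'.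
Proof.
move=> w st; move: w; case: st => {k ev k'}.
- move=> al mu rho chi Phi x y A B k alA fx fy xy [Bd Bchi fB] w.
  apply: (wf_update w) => [C|f C|u v|m C|C|C] //=.
  + by rewrite /known_actor /= ?dom_setf !inE => /orP[]->; rewrite ?orbT.
  + rewrite !kn_set; case: eqP => [->|_] /=.
      rewrite !fset_memE -orbA => /or3P[]/eqP->; right; split=> // r;
      by rewrite inE => /eqP->; rewrite /known_actor /= ?dom_setf !inE eqxx.
    case: eqP => [->|_]; last by left.
    rewrite in_fset1U => /predU1P[->|fP]; last by left; rewrite (knE alA).
    right; split=> // r; rewrite inE => /eqP->.
    by rewrite /known_actor /= ?dom_setf !inE eqxx.
  + rewrite /holds !kn_set /=; case: eqP => [_|nB] /=; first by rewrite !fset_memE !fact_eqE.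
    case: eqP => [uA|nA] /=.
      rewrite !in_fset1U !fact_eqE orFb => uP.
      by have /= [-> ->] := wf_using_in w alA uP; rewrite orbT.
    by move=> h; have := @wf_using _ w u v h.
  + by left.
  + move=> Cchi; rewrite ?dom_setf !inE !negb_or; have := wf_disjoint w Cchi => -> /=.
    rewrite andbT; apply/andP; split; first by apply: contraNneq Bchi => <-.
    by apply: contraTneq (domf_some alA) => <-; exact: (wf_disjoint w Cchi).
  + by move=> /(wf_rho w) h; rewrite ?dom_setf !inE h !orbT.
- move=> al mu rho chi Phi x l A B k alA dx dl ul w.
  have knA := knE alA.
  have xP := derives_activated dx.
  have kB : known_actor k B.
    exact: (@wf_known _ _ _ _ (Refob x A B) w alA xP (mem_head _ _)).
  have kC a b C : (a, b, C) \in l -> known_actor k C.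
    move=> /dl[/derives_activated h _].
    exact: (@wf_known _ _ _ _ (Refob a A C) w alA h (mem_head _ _)).
  apply: (wf_actor w alA) => /= [f|u v|m C].
  + rewrite in_fsetU => /orP[/in_IncSent[fP|[n ->]]|/using_setE[a [b [C [abC ->]]]]].
    * by left.
    * by right; split=> // r; rewrite inE => /eqP->.
    * right; split=> // r; rewrite !inE => /orP[]/eqP->; exact: kC abC.
  + rewrite !in_fsetU !mem_IncSent // => /orP[h|/using_setE[a [b [C [abC [-> ->]]]]]] _.
      by have /= [-> ->] := wf_using_in w alA h.
    by have [/derives_activated -> _] := dl _ _ _ abC.
  + rewrite in_send => /orP[/andP[/eqP-> /eqP->]|]; last by left.
    right; split=> [|r].
      by split=> // r /app_setE[a [b [D [_ ->]]]].
    by rewrite inE => /orP[/eqP->//|/app_setE[a [b [D [/kC abC ->]]]]].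
- move=> al mu rho chi Phi x B R alB xB w.
  have knB := knE alB.
  have [[tx oR] tR] := wf_msg w xB.
  apply: (wf_actor w alB) => /= [f|u v|m C].
  + rewrite in_fsetU => /orP[/in_IncRecv[fP|[n ->]]|/imfsetP[r /= rR ->]].
    * by left.
    * by right; split=> // r; rewrite inE => /eqP->; apply: tR; rewrite inE eqxx.
    * right; split=> [|z]; first exact: oR.
      by rewrite inE => /eqP->; apply: tR; rewrite inE rR orbT.
  + rewrite !in_fsetU !mem_IncRecv // => /orP[h _|/imfsetP[]//].
    by have /= [-> ->] := wf_using_in w alB h.
  + by move=> /in_consume; left.
- move=> al mu rho chi Phi A alA w; have knA := knE alA.
  apply: (wf_actor w alA) => /= [f|u v|m C]; try by left.
  by move=> h _; exact: (wf_using_in w alA h).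
- move=> al mu rho chi Phi y z A B C alA yzP w; have knA := knE alA.
  have kC := @wf_known _ _ _ _ (Refob y A C) w alA yzP (mem_head _ _).
  apply: (wf_actor w alA) => /= [f|u v|m D].
  + move=> /in_IncSent[|[n ->]]; first by rewrite in_fsetD1 => /andP[_]; left.
    by right; split=> // r; rewrite inE => /eqP->.
  + rewrite !mem_IncSent // !in_fsetD1 fact_eqE /= => /andP[_ h] uA.
    exact: (wf_using_in w alA h).
  + rewrite in_send => /orP[/andP[/eqP-> /eqP->]|]; last by left.
    by right; split=> // r; rewrite !inE => /orP[]/eqP->.
- move=> al mu rho chi Phi y z B C alC yzC w; have knC := knE alC.
  have [[ty _ _] tR] := wf_msg w yzC.
  have kC : known_actor (Config al mu rho chi) C := tR (Refob z B C) (mem_last _ [:: _]).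
  apply: (wf_actor w alC) => /= [f|u v|m D].
  + rewrite in_fset1U => /predU1P[->|/in_IncRecv[fP|[n ->]]].
    * by right; split=> // r; rewrite inE => /eqP->.
    * by left.
    * by right; split=> // r; rewrite inE => /eqP->; rewrite ty.
  + rewrite !in_fset1U !mem_IncRecv // !fact_eqE /= => h uA.
    exact: (wf_using_in w alC h).
  + by move=> /in_consume; left.
- move=> al mu rho chi Phi x n A B alA dx dn nx w; have knA := knE alA.
  have xP := derives_activated dx.
  have kB := @wf_known _ _ _ _ (Refob x A B) w alA xP (mem_head _ _).
  apply: (wf_actor w alA) => /= [f|u v|m C].
  + by rewrite in_fsetD => /andP[_]; left.
  + rewrite !in_fsetD !inE => /andP[_ h] uA.
    have /= [-> ->] := wf_using_in w alA h.
    split=> //; rewrite andbT fact_eqE negb_or /= andbT.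
    (* The activation removed is not that of [u]: the guard of SendRelease forbids a remaining
       creation fact using [x]. *)
    by apply: contraTneq h => ->; apply: nx.
  + rewrite in_send => /orP[/andP[/eqP-> /eqP->]|]; last by left.
    by right; split=> // r; rewrite !inE => /eqP->.
- move=> al mu rho chi Phi x n A B alB xB dn w; have knB := knE alB.
  have [_ tR] := wf_msg w xB.
  have kB : known_actor (Config al mu rho chi) B := tR (Refob x A B) (mem_head _ _).
  apply: (wf_actor w alB) => /= [f|u v|m C].
  + rewrite in_fset1U => /predU1P[->|fP]; last by left.
    by right; split=> // r; rewrite inE => /eqP->.
  + rewrite !in_fset1U !fact_eqE /= => h uA.
    exact: (wf_using_in w alB h).
  + by move=> /in_consume; left.
- move=> al mu rho chi Phi x B C alC cP rP w; have knC := knE alC.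
  apply: (wf_actor w alC) => /= [f|u v|m D].
  + by rewrite !inE => /andP[]; left.
  + rewrite !inE !fact_eqE /= !andbT => h uA.
    exact: (wf_using_in w alC h).
  + by left.
- by [].
- move=> al mu rho chi x A R k Arho tx ox hR injR w.
  apply: (wf_update w) => [C|f C|u v|m C|C|C] //=.
  + by rewrite /known_actor /= !inE => /orP[]->; rewrite ?orbT.
  + by left.
  + exact: (wf_using w).
  + rewrite in_send => /orP[/andP[/eqP-> /eqP->]|]; last by left.
    right; split; first by split=> // r /hR[].
    move=> r; rewrite inE => /predU1P[->|rR]; rewrite /known_actor /=.
      by rewrite tx (wf_rho w Arho).
    rewrite !inE; case: (boolP (target r \in domf al)) => //= ndr.
    by apply/orP; right; apply/imfsetP; exists r.
  + rewrite !inE => /orP[|/andP[]//]; exact: (wf_disjoint w).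
  + exact: (wf_rho w).
- move=> al mu rho chi x B R Bchi xB w.
  apply: (wf_update w) => [C|f C|u v|m C|C|C] //=.
  + by left.
  + exact: (wf_using w).
  + by move=> /in_consume; left.
  + exact: (wf_disjoint w).
  + rewrite !inE => /orP[|/andP[]//]; exact: (wf_rho w).
- move=> al mu rho chi x n B Bchi xB w.
  apply: (wf_update w) => [C|f C|u v|m C|C|C] //=.
  + by left.
  + exact: (wf_using w).
  + by move=> /in_consume; left.
  + exact: (wf_disjoint w).
  + exact: (wf_rho w).
- move=> al mu rho chi y z A B Bchi xB w.
  apply: (wf_update w) => [C|f C|u v|m C|C|C] //=.
  + by left.
  + exact: (wf_using w).
  + by move=> /in_consume; left.
  + exact: (wf_disjoint w).
  + exact: (wf_rho w).
Qed.

(** * Life cycle of a refob *)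

(** The traffic concerning [x]: messages carrying it to its owner, Release and Info messages about
    it on the way to its target, and messages in flight along it. *)
Definition pend k x := count (app_carrying x) (undelivered k (owner x)).
Definition relm k x := count (release_of x) (undelivered k (target x)).
Definition infm k x := count (info_about x) (undelivered k (target x)).
Definition infl k x := count (counted_on x) (undelivered k (target x)).
(* The number of places where [x] is in its life cycle; messages are counted
   with multiplicity, so that a bound of 1 also excludes duplicates. *)
Definition stage k x :=
  pend k x + holds (internal k) (Activated x) + relm k x
  + holds (internal k) (Released x).
(** The announcements of the creation of [x] to its target. Until SendInfo the creation of a refob
    made by Send is recorded by a [CreatedUsing] fact instead. *)
Definition intro k x := infm k x + holds (internal k) (Created x).
(** Counts are read through [derives], so a missing count reads as 0. *)
Definition sent k x n := derives (kn (internal k) (owner x)) (SentCount x n).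
Definition recv k x n := derives (kn (internal k) (target x)) (RecvCount x n).
(** An owner outside the system keeps no send count, so the balance of counts is claimed only for
    these refobs. *)
Definition inside k x : bool :=
  (owner x \in domf (internal k)) && (target x \in domf (internal k)).

(** The clauses on [CreatedUsing] and [intro] make the record of a creation unique, so that
    Compaction, erasing one, leaves none behind. The exception in [life_live] arises when an
    external actor consumes the message carrying [x]. Nothing is counted before activation
    ([life_pend]), which starts the balance [life_sent]; SendRelease freezes that balance in its
    message ([life_release]). *)
Record life k : Prop := Life {
  life_stage x : stage k x <= 1;
  life_using u v x : holds (internal k) (CreatedUsing u x) ->
    holds (internal k) (CreatedUsing v x) -> u = v;
  life_using_intro u x : holds (internal k) (CreatedUsing u x) -> intro k x = 0;
  life_intro x : intro k x <= 1;
  life_live x : target x \in domf (internal k) ->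
    0 < intro k x \/ (exists u, holds (internal k) (CreatedUsing u x)) ->
    0 < stage k x \/
    (owner x \notin domf (internal k)) && (target x \in receptionists k);
  life_sent x n m : inside k x -> holds (internal k) (Activated x) ->
    sent k x n -> recv k x m -> n = m + infl k x;
  life_release x n m : inside k x -> ReleaseMsg x n \in undelivered k (target x) ->
    recv k x m -> n = m + infl k x;
  life_pend x n m : inside k x -> 0 < pend k x -> sent k x n -> recv k x m ->
    n = 0 /\ m + infl k x = 0 }.

Lemma release_gt0 k x n : ReleaseMsg x n \in undelivered k (target x) -> 0 < relm k x.
Proof. by move=> h; apply/mset_has_count; exists (ReleaseMsg x n) => /=. Qed.

Lemma stage_activated k x : holds (internal k) (Activated x) -> 0 < stage k x.
Proof. by rewrite /stage => ->; lia. Qed.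

Lemma absent_kn k r A f : ~ occurs k r -> r \in fact_refobs f ->
  f \notin kn (internal k) A.
Proof.
move=> nr rf; apply/negP; rewrite /kn; case e : (_.[? A]) => [s|//] fs.
by apply: nr; left; exists A, s, f.
Qed.

Lemma absent_count k r (p : pred msg) B : ~ occurs k r ->
  (forall m, p m -> r \in msg_refobs m) -> count p (undelivered k B) = 0.
Proof.
move=> nr pr; apply/eqP; rewrite -leqn0 leqNgt; apply/mset_has_count => -[m mB /pr rm].
by apply: nr; right; exists B, m.
Qed.

(** This is how freshness enters the invariants: a refob without any trace starts in no stage, with
    no record of creation and with all counts 0. *)
Lemma absent k r : ~ occurs k r -> [/\ stage k r = 0, intro k r = 0,
  forall u, ~~ holds (internal k) (CreatedUsing u r)
  & forall n m, sent k r n -> recv k r m -> [/\ n = 0, m = 0 & infl k r = 0]].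
Proof.
move=> nr; have h f : r \in fact_refobs f -> holds (internal k) f = false.
  by move=> rf; apply/negbTE; apply: (absent_kn _ nr).
have c := absent_count _ nr.
have infl0 : infl k r = 0.
  apply: c => -[u R|u v B|//] /= /eqP->; by rewrite inE eqxx.
split.
- rewrite /stage !h ?inE //= !addn0 /pend /relm !c //.
    by case=> //= u n /eqP->; rewrite inE.
  by case=> //= u R rR; rewrite inE rR orbT.
- rewrite /intro !h ?inE //= !addn0 /infm c //.
  by case=> //= u v B /eqP->; rewrite !inE eqxx orbT.
- by move=> u; rewrite h // !inE eqxx orbT.
- move=> n m /derives_sent_none -> => [/derives_recv_none -> //|] i;
  by apply: (absent_kn _ nr); rewrite inE.
Qed.

Lemma uniq_map_eq (T U : eqType) (f : T -> U) (s : seq T) (a b : T) :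
  uniq (map f s) -> a \in s -> b \in s -> f a = f b -> a = b.
Proof.
elim: s => //= c s IH /andP[cs us]; rewrite !inE.
case/predU1P => [->|as_] /predU1P[->|bs] // e; last exact: IH.
  by case/negP: cs; rewrite e map_f.
by case/negP: cs; rewrite -e map_f.
Qed.

Lemma sent_set k k' A s s' x n :
  (internal k).[? A] = Some s -> internal k' = (internal k).[A <- s'] ->
  (forall m, (SentCount x m \in knowledge_of s') = (SentCount x m \in knowledge_of s)) ->
  sent k' x n -> sent k x n.
Proof.
move=> alA ek e; rewrite /sent ek kn_set; case: eqP => [->|//].
by rewrite (knE alA); apply: derives_sent_eq.
Qed.

Lemma recv_set k k' A s s' x n :
  (internal k).[? A] = Some s -> internal k' = (internal k).[A <- s'] ->
  (forall m, (RecvCount x m \in knowledge_of s') = (RecvCount x m \in knowledge_of s)) ->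
  recv k' x n -> recv k x n.
Proof.
move=> alA ek e; rewrite /recv ek kn_set; case: eqP => [->|//].
by rewrite (knE alA); apply: derives_recv_eq.
Qed.

(** * The life-cycle invariants hold initially and are preserved by every event *)

Lemma life_initial k : initial k -> life k.
Proof.
case=> A [E [x [y [AE xy ->]]]].
pose s := Busy [fset Activated (Refob x A E); Created (Refob y A A); Activated (Refob y A A)].
rewrite -[Busy _]/s; pose al : {fmap actor -> astate} := [fmap].[A <- s].
have H f : holds al f = (f \in knowledge_of s).
  rewrite /holds /al kn_set; case: eqP => // nA; rewrite /kn fnd_fmap0.
  by apply/esym/negbTE; apply/negP => /=; rewrite !fset_memE -orbA => /or3P[]/eqP fE;
    apply: nA; rewrite fE.
rewrite -/al; split=> [u|u v w|u v|u|u|u n m|u n m|u n m] /=.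
- by rewrite /stage /pend /relm /= enum_mset0 !H /= !fset_memE !fact_eqE /=; case: (_ || _).
- by rewrite H /= !fset_memE !fact_eqE.
- by rewrite H /= !fset_memE !fact_eqE.
- by rewrite /intro /infm /= enum_mset0; case: holds.
- move=> _; rewrite /intro /infm /= enum_mset0 add0n => -[|[v]]; rewrite H /= !fset_memE !fact_eqE //.
  (* The only refob recorded as created is the self-reference, which is activated too. *)
  by rewrite /= orbF => yu; left; rewrite /stage /= !H /= !fset_memE !fact_eqE; lia.
- move=> _ _; rewrite /sent /recv /infl /= enum_mset0 /al !kn_set => sn rn.
  have -> : n = 0.
    apply: derives_sent_none sn => i; case: eqP => _; last by rewrite /kn fnd_fmap0.
    by rewrite /= !fset_memE.
  have -> // : m = 0.
    apply: derives_recv_none rn => i; case: eqP => _; last by rewrite /kn fnd_fmap0.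
    by rewrite /= !fset_memE.
- by rewrite in_mset0.
- by rewrite /pend /= enum_mset0.
Qed.

(** Two fresh refobs appear directly in the activated stage. A refob that occurred before does not
    mention the fresh actor [B], so [inside] is unchanged for it. *)
Lemma life_spawn al mu rho chi Phi (x y : token) (A B : actor) :
  let k := Config al mu rho chi in
  life k ->
  al.[? A] = Some (Busy Phi) ->
  fresh_token k x -> fresh_token k y -> x <> y -> fresh_actor k B ->
  life (Config
         al.[A <- Busy (Activated (Refob x A B) |` Phi)]
           .[B <- Busy [fset Created (Refob x A B);
                             Created (Refob y B B);
                             Activated (Refob y B B)]]
         mu rho chi).
Proof.
move=> k L alA fx fy xy [Bd Bchi fB].
have AB : A != B by apply: contraNneq Bd => <-; apply: domf_some alA.
set x0 := Refob x A B; set y0 := Refob y B B; set al' := _.[B <- _].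
have nx0 : ~ occurs k x0 by move/fx.
have ny0 : ~ occurs k y0 by move/fy.
have x0y0 : x0 == y0 = false by apply/eqP => -[].
have knB : kn al B = fset0 by move: Bd; rewrite /kn /=; case: fndP.
have knal' C : kn al' C = if C == B then [fset Created x0; Created y0; Activated y0]
    else if C == A then Activated x0 |` Phi else kn al C.
  by rewrite /al' !kn_set.
have dA := domf_some alA.
have dE C : (C \in domf al') = [|| C == B, C == A | C \in domf al].
  by rewrite /al' !dom_setf !inE.
pose k' := Config al' mu rho chi; rewrite -/k'.
(* [H] tracks the facts other than counts, [SE] and [RE] trace derivable counts back to the
   configuration before the step, [stE] and [inE'] compare stages and announcements. Most of the
   other events follow this pattern. *)
have H f : ~~ is_count f ->
    holds al' f = holds al f || [|| f == Activated x0, f == Created x0, f == Created y0 | f == Activated y0].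
  move=> nc; rewrite /holds knal'.
  case: (eqVneq (fact_holder f) B) => [fB'|fB'].
    rewrite fB' knB in_fset0 !fset_memE.
    have /negPf-> : f != Activated x0.
      by apply: contraNneq AB => fE; rewrite fE in fB'; apply/eqP.
    by move: (f == _) (f == _) (f == _) => [] [] [].
  have n1 : f == Created x0 = false by apply: contra_neqF fB' => /eqP->.
  have n2 : f == Created y0 = false by apply: contra_neqF fB' => /eqP->.
  have n3 : f == Activated y0 = false by apply: contra_neqF fB' => /eqP->.
  rewrite n1 n2 n3 !orbF; case: (eqVneq (fact_holder f) A) => [->|nA].
    by rewrite in_fset1U (knE alA) orbC.
  have /negPf-> : f != Activated x0 by apply: contraNneq nA => ->.
  by rewrite orbF.
have SE v n : sent k' v n -> sent k v n.
  apply: derives_sent_eq => m; rewrite /= knal'.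
  case: eqP => [->|_]; first by rewrite knB in_fset0 !fset_memE.
  by case: eqP => [->|//]; rewrite (knE alA) in_fset1U.
have RE v n : recv k' v n -> recv k v n.
  apply: derives_recv_eq => m; rewrite /= knal'.
  case: eqP => [->|_]; first by rewrite knB in_fset0 !fset_memE.
  by case: eqP => [->|//]; rewrite (knE alA) in_fset1U.
have stE v : stage k' v <= stage k v + (v == x0) + (v == y0).
  by rewrite /stage /pend /relm /= !H // !fact_eqE /=; lia.
have inE' v : intro k' v <= intro k v + (v == x0) + (v == y0).
  by rewrite /intro /infm /= !H // !fact_eqE /=; lia.
have stG v : stage k v <= stage k' v.
  by rewrite /stage /pend /relm /= !H // !fact_eqE /=; lia.
have UE u v : holds al' (CreatedUsing u v) = holds al (CreatedUsing u v).
  by rewrite H // !fact_eqE /= orbF.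
have oB v : occurs k v -> owner v != B /\ target v != B.
  by move=> /fB[/eqP ? /eqP ?].
have oxy v : occurs k v -> (v == x0 = false) /\ (v == y0 = false).
  by move=> ov; split; apply/eqP => vE; move: ov; rewrite vE.
have insE v : occurs k v -> inside k' v = inside k v.
  move=> /oB[/negPf o /negPf t]; rewrite /inside /= !dE o t /=.
  by do 2!case: eqP => [->|_]; rewrite ?dA.
have [ax0 ix0 _ cx0] := absent nx0; have [ay0 iy0 _ cy0] := absent ny0.
split=> [v|u u' v|u v|v|v|v n m|v n m|v n m].
- have := stE v; have := life_stage L v.
  case: (eqVneq v x0) => [->|_]; first by rewrite ax0 x0y0.
  by case: (eqVneq v y0) => [->|_]; [rewrite ay0 | lia].
- rewrite !UE; exact: (life_using L).
- rewrite UE => h; have := life_using_intro L h; have := inE' v.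
  have [ov|nov] := pselect (occurs k v); first by have [-> ->] := oxy v ov; lia.
  by have [_ _ /(_ u)] := absent nov; rewrite h.
- have := inE' v; have := life_intro L v.
  case: (eqVneq v x0) => [->|_]; first by rewrite ix0 x0y0.
  by case: (eqVneq v y0) => [->|_]; [rewrite iy0 | lia].
- move=> td h; have := stE v.
  case: (eqVneq v x0) => [->|vx].
    by left; apply: stage_activated; rewrite /= H // !eqxx !orbT.
  case: (eqVneq v y0) => [->|vy].
    by left; apply: stage_activated; rewrite /= H // !eqxx !orbT.
  rewrite !addn0 => stv.
  have h' : 0 < intro k v \/ exists u, holds al (CreatedUsing u v).
    case: h => [h|[u]]; last by rewrite UE; right; exists u.
    by left; have := inE' v; rewrite (negPf vx) (negPf vy); lia.
  have [ov|nov] := pselect (occurs k v); last first.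
    have [_ i0 u0 _] := absent nov; case: h' => [|[u]]; first by rewrite i0.
    by move=> hu; have := u0 u; rewrite hu.
  have [oo ot] := oB _ ov.
  have td' : target v \in domf al by move: td; rewrite dE (negPf ot) /= => /predU1P[->|].
  case: (life_live L td' h') => [|/andP[od tr]]; first by have := stG v; left; lia.
  right; rewrite /= tr andbT dE (negPf oo) (negPf od) orbF /=.
  by apply: contra od => /eqP->.
- move=> ins hA /SE sn /RE rn.
  have [ov|nov] := pselect (occurs k v).
    rewrite insE // in ins; have [vx vy] := oxy _ ov.
    by apply: (life_sent L ins) sn rn; move: hA; rewrite H // !fact_eqE vx vy /= orbF.
  (* Here [v] may be a new refob, whose counts and messages in flight are all 0. *)
  by have [_ _ _ /(_ _ _ sn rn)[-> -> i0]] := absent nov; rewrite -[infl k' v]/(infl k v) i0.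
- move=> ins rv /RE rn.
  have ov : occurs k v.
    by right; exists (target v), (ReleaseMsg v n); split=> //; rewrite inE.
  by rewrite insE // in ins; exact: (life_release L ins rv rn).
- move=> ins pv /SE sn /RE rn.
  have [ov|nov] := pselect (occurs k v).
    by rewrite insE // in ins; exact: (life_pend L ins pv sn rn).
  by have [_ _ _ /(_ _ _ sn rn)[-> -> i0]] := absent nov; rewrite -[infl k' v]/(infl k v) i0.
Qed.

(** The new refobs become pending, each recorded by one [CreatedUsing] fact. The send count of the
    used refob grows together with its messages in flight; being activated, it is neither pending
    nor under release, so [life_stage] protects the clauses for those stages. *)
Lemma life_send al mu rho chi Phi (x : token)
    (l : seq (token * token * actor)) (A B : actor) :
  let k := Config al mu rho chi in
  life k ->
  al.[? A] = Some (Busy Phi) ->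
  derives Phi (Activated (Refob x A B)) ->
  (forall (a b : token) (C : actor), (a, b, C) \in l ->
     derives Phi (Activated (Refob a A C)) /\ fresh_token k b) ->
  uniq [seq p.1.2 | p <- l] ->
  life (Config
         al.[A <- Busy (IncSent (Refob x A B) Phi `|`
                        [fset CreatedUsing (Refob p.1.1 A p.2)
                                           (Refob p.1.2 B p.2) | p in l])]
         (send mu B (AppMsg (Refob x A B) [fset Refob p.1.2 B p.2 | p in l]))
         rho chi).
Proof.
move=> k L alA dx dl ul; set x0 := Refob x A B.
set U := [fset _ | p in l]; set Z := [fset _ | p in l].
move e' : al.[A <- _] => al'; set mu' := send _ _ _; pose k' := Config al' mu' rho chi.
have xP := derives_activated dx; have knA := knE alA.
have ax0 : holds al (Activated x0) by rewrite /holds /= knA.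
have dE : domf al' = domf al by rewrite -e' (domf_set _ alA).
have insE v : inside k' v = inside k v by rewrite /inside /= dE.
have nU f : (if f is CreatedUsing _ _ then false else true) -> f \in U = false.
  by move=> nf; apply/negbTE/negP => /using_setE[a [b [C [_ fE]]]]; rewrite fE in nf.
have H f : ~~ is_count f -> holds al' f = holds al f || (f \in U).
  move=> nc; rewrite -e' (holds_set (del := pred0) (add := mem U) alA) ?andbT //=.
    by rewrite in_fsetU mem_IncSent ?andbT //; case: f nc.
  by case/using_setE=> a [b [C [_ ->]]].
have SE v n : sent k' v n -> exists2 m, sent k v m & n = m + (v == x0).
  rewrite /sent /= -e' kn_set; case: eqP => [->|nA] sn.
    rewrite knA; apply: derives_IncSent; apply: derives_sent_eq sn => m.
    by rewrite in_fsetU nU // orbF.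
  by exists n => //; case: eqP nA => [->|] //; rewrite addn0.
have RE v n : recv k' v n -> recv k v n.
  apply: (@recv_set k k' _ _ _ _ _ alA (esym e')) => m /=.
  by rewrite in_fsetU nU // orbF mem_IncSent.
have Zfresh v : v \in Z -> ~ occurs k v.
  by case/app_setE=> a [b [C [/dl[_ fb] ->]]] /fb.
have ZB v : v \in Z -> owner v = B by case/app_setE=> a [b [C [_ ->]]].
have UZ u v : CreatedUsing u v \in U -> v \in Z.
  case/using_setE=> a [b [C [abC [_ ->]]]].
  by apply/imfsetP; exists (a, b, C).
have x0Z : x0 \in Z = false.
  apply/negbTE/negP => /Zfresh[]; left; exists A, (Busy Phi), (Activated x0).
  by rewrite inE.
have pE v : pend k' v = (v \in Z) + pend k v.
  rewrite /pend /= count_send /=; case: (boolP (v \in Z)) => vZ; last by rewrite andbF.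
  by rewrite (ZB v vZ) eqxx.
have stE v : stage k' v = (v \in Z) + stage k v.
  by rewrite /stage pE /relm /= count_send /= !H // !nU // andbF !orbF; lia.
have inE' v : intro k' v = intro k v.
  by rewrite /intro /infm /= count_send H // nU // andbF orbF.
have fE v : infl k' v = (v == x0) + infl k v.
  rewrite /infl /= count_send /= [x0 == v]eq_sym; case: (v =P x0)  => [->|_]; last by rewrite andbF.
  by rewrite eqxx.
rewrite -/k'; split=> [v|u u' v|u v|v|v|v n m|v n m|v n m].
- rewrite stE; case: (boolP (v \in Z)) => [/Zfresh/absent[-> _ _ _]//|_].
  exact: (life_stage L).
- rewrite !H //=; case: (boolP (v \in Z)) => [vZ|vZ]; last first.
    have n w : CreatedUsing w v \in U = false by apply: contraNF vZ => /UZ.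
    by rewrite !n !orbF; apply: (life_using L).
  have [_ _ no _] := absent (Zfresh _ vZ); rewrite (negPf (no u)) (negPf (no u')) /=.
  case/using_setE=> a [b [C [abC [-> ->]]]] /using_setE[a' [b' [C' [abC' [-> e1 e2]]]]].
  (* The tokens created by one Send are distinct, so equal new refobs come from the same entry of
     [l]. *)
  by have [-> _ ->] := uniq_map_eq ul abC abC' e1.
- rewrite inE' H // => /orP[|/UZ/Zfresh/absent[] //].
  exact: (life_using_intro L).
- rewrite inE'; exact: (life_intro L).
- rewrite /= dE inE' => td h; rewrite stE.
  case: (boolP (v \in Z)) => [_|vZ]; first by left.
  apply: (life_live L td); case: h => [|[u]]; first by left.
  rewrite H // => /orP[|/UZ uZ]; first by right; exists u.
  by rewrite uZ in vZ.
- rewrite insE fE H // nU // orbF => ins av /SE[n' sn ->] /RE rn.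
  by have := life_sent L ins av sn rn; lia.
- rewrite insE fE in_send andbC /= => ins rv /RE rn.
  have := life_release L ins rv rn; have := @release_gt0 k _ _ rv; have := life_stage L v.
  case: eqP => [->|//]; rewrite /stage /= ax0; lia.
- rewrite insE fE pE => ins pv /SE[n' sn ->] /RE rn.
  case: (boolP (v \in Z)) pv => [vZ _|vZ pv].
    have [_ _ _ /(_ _ _ sn rn)[-> -> ->]] := absent (Zfresh _ vZ).
    by case: eqP vZ => [->|//]; rewrite x0Z.
  have [-> e] := life_pend L ins pv sn rn; have := life_stage L v.
  case: eqP pv => [->|_]; last by rewrite e.
  by rewrite /stage /= ax0; lia.
Qed.

(** The refobs in [R] move from pending to activated, where [life_pend] supplies their initial
    balance. On [x] one message moves from in flight to the receive count. *)
Lemma life_receive al mu rho chi Phi x (B : actor) R :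
  let k := Config al mu rho chi in
  wf k -> life k ->
  al.[? B] = Some (Idle Phi) -> AppMsg x R \in mu B ->
  life (Config al.[B <- Busy (IncRecv x Phi `|` [fset Activated z | z in R])]
         (consume mu B (AppMsg x R)) rho chi).
Proof.
move=> k W L alB xB; set U := [fset _ | z in R].
move e' : al.[B <- _] => al'; set mu' := consume _ _ _; pose k' := Config al' mu' rho chi.
have knB := knE alB; have [[tx oR] _] := wf_msg W xB.
have dE : domf al' = domf al by rewrite -e' (domf_set _ alB).
have insE v : inside k' v = inside k v by rewrite /inside /= dE.
have inU f : f \in U = if f is Activated v then v \in R else false.
  apply/imfsetP/idP => [[v vR ->] //|]; by case: f => // v vR; exists v.
have H f : ~~ is_count f -> holds al' f = holds al f || (f \in U).
  move=> nc; rewrite -e' (holds_set (del := pred0) (add := mem U) alB) ?andbT //=.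
    by rewrite in_fsetU mem_IncRecv ?andbT //; case: f nc.
  by rewrite inU; case: f {nc} => // v /oR.
have RE v n : recv k' v n -> exists2 m, recv k v m & n = m + (v == x).
  rewrite /recv /= -e' kn_set; case: eqP => [->|nA] sn.
    rewrite knB; apply: derives_IncRecv; apply: derives_recv_eq sn => m.
    by rewrite in_fsetU inU orbF.
  by exists n => //; case: eqP nA => [->|] //; rewrite addn0.
have SE v n : sent k' v n -> sent k v n.
  apply: (@sent_set k k' _ _ _ _ _ alB (esym e')) => m /=.
  by rewrite in_fsetU inU orbF mem_IncRecv.
have pE v : pend k v = (v \in R) + pend k' v.
  rewrite /pend /= (count_consume _ _ xB) /=; case: (boolP (v \in R)) => vR; last by rewrite andbF.
  by rewrite (oR v vR) eqxx.
(* The sum is exact: by [life_stage] a refob carried in [R] is not activated yet. *)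
have aE v : (holds al' (Activated v) : nat) = (v \in R) + holds al (Activated v).
  rewrite H // inU; have := life_stage L v; rewrite /stage pE /=; lia.
have relE v : relm k v = relm k' v.
  by rewrite /relm /= (count_consume _ _ xB) /= andbF.
have stE v : stage k' v = stage k v.
  by rewrite /stage pE /= aE relE H // inU orbF (addnA (pend k' v)) (addnC (pend k' v)).
have inE' v : intro k' v = intro k v.
  by rewrite /intro /infm /= (count_consume _ _ xB) H // inU andbF orbF.
have fE v : infl k v = (v == x) + infl k' v.
  rewrite /infl /= (count_consume _ _ xB) /= [x == v]eq_sym; case: (v =P x) => [->|_]; last by rewrite andbF.
  by rewrite tx eqxx.
have UE u v : holds al' (CreatedUsing u v) = holds al (CreatedUsing u v).
  by rewrite H // inU orbF.
rewrite -/k'; split=> [v|u u' v|u v|v|v|v n m|v n m|v n m].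
- rewrite stE; exact: (life_stage L).
- rewrite !UE; exact: (life_using L).
- rewrite UE inE'; exact: (life_using_intro L).
- rewrite inE'; exact: (life_intro L).
- rewrite /= dE inE' stE => td h; apply: (life_live L td).
  by case: h => [|[u]]; [left | rewrite UE; right; exists u].
- rewrite insE H // inU => ins /orP[av|vR] /SE sn /RE[m' rn ->].
    by have := life_sent L ins av sn rn; rewrite fE; lia.
  have := life_pend L ins _ sn rn; rewrite pE vR fE => /(_ isT); lia.
- rewrite insE => ins /in_consume rv /RE[m' rn ->].
  by have := life_release L ins rv rn; rewrite fE; lia.
- rewrite insE => ins pv /SE sn /RE[m' rn ->].
  have := life_pend L ins _ sn rn; rewrite pE fE => h; have {}h := h (ltn_addl _ pv); lia.
Qed.

(** The invariants read knowledge through [kn], which does not see whether an actor is busy. *)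
Lemma life_idle al mu rho chi Phi (A : actor) :
  let k := Config al mu rho chi in
  life k -> al.[? A] = Some (Busy Phi) ->
  life (Config al.[A <- Idle Phi] mu rho chi).
Proof.
move=> k L alA; have dE := domf_set (Idle Phi) alA.
have e : kn al.[A <- Idle Phi] = kn al.
  by apply/funext => C; rewrite kn_set; case: eqP => // ->; rewrite (knE alA).
case: L; rewrite /k /stage /intro /sent /recv /inside /holds /= -e -dE => *.
by split; rewrite /stage /intro /sent /recv /inside /holds.
Qed.

(** The record of the creation of [z] moves from a fact into an Info message, raising [intro] from 0
    to 1. The message is counted on [y], which [wf_using] shows to be activated. *)
Lemma life_send_info al mu rho chi Phi (y z : token) (A B C : actor) :
  let k := Config al mu rho chi in
  wf k -> life k ->
  al.[? A] = Some (Busy Phi) ->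
  CreatedUsing (Refob y A C) (Refob z B C) \in Phi ->
  life (Config
         al.[A <- Busy (IncSent (Refob y A C)
                          (Phi `\ CreatedUsing (Refob y A C) (Refob z B C)))]
         (send mu C (InfoMsg (Refob y A C) (Refob z B C) B)) rho chi).
Proof.
move=> k W L alA; set y0 := Refob y A C; set z0 := Refob z B C => yzP.
move e' : al.[A <- _] => al'; set mu' := send _ _ _; pose k' := Config al' mu' rho chi.
have knA := knE alA.
have ay0 : holds al (Activated y0).
  by have [_] := wf_using_in W alA yzP; rewrite /holds /= knA.
have uyz : holds al (CreatedUsing y0 z0) by rewrite /holds /= knA.
have dE : domf al' = domf al by rewrite -e' (domf_set _ alA).
have insE v : inside k' v = inside k v by rewrite /inside /= dE.
have H f : ~~ is_count f -> holds al' f = holds al f && (f != CreatedUsing y0 z0).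
  move=> nc.
  rewrite -e' (holds_set (del := pred1 (CreatedUsing y0 z0)) (add := pred0) alA) ?orbF //=.
    by rewrite mem_IncSent ?in_fsetD1 ?orbF 1?andbC //; case: f nc.
  by move/eqP->.
have SE v n : sent k' v n -> exists2 m, sent k v m & n = m + (v == y0).
  rewrite /sent /= -e' kn_set; case: eqP => [->|nA] sn.
    rewrite knA; have [m sm ->] := derives_IncSent sn; exists m => //.
    by apply: derives_sent_eq sm => i; rewrite in_fsetD1.
  by exists n => //; case: eqP nA => [->|] //; rewrite addn0.
have RE v n : recv k' v n -> recv k v n.
  apply: (@recv_set k k' _ _ _ _ _ alA (esym e')) => m /=.
  by rewrite mem_IncSent // in_fsetD1.
have pE v : pend k' v = pend k v by rewrite /pend /= count_send andbF.
have stE v : stage k' v = stage k v.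
  by rewrite /stage pE /relm /= count_send andbF !H // !fact_eqE !andbT.
have inE' v : intro k' v = (z0 == v) + intro k v.
  rewrite /intro /infm /= count_send H // fact_eqE andbT /= addnA.
  by case: (z0 =P v) => [<-|_]; rewrite ?eqxx ?andbF.
have fE v : infl k' v = (v == y0) + infl k v.
  rewrite /infl /= count_send /= [y0 == v]eq_sym; case: (v =P y0) => [->|_]; last by rewrite andbF.
  by rewrite eqxx.
have UE u v : holds al' (CreatedUsing u v) -> holds al (CreatedUsing u v) /\ z0 == v = false.
  (* No creation fact for [z] is left: by [life_using] it would be the one removed. *)
  rewrite H // => /andP[h ne]; split=> //; apply/eqP => zv; case/negP: ne.
  by rewrite -zv in h *; rewrite (life_using L h uyz).
rewrite -/k'; split=> [v|u u' v|u v|v|v|v n m|v n m|v n m].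
- rewrite stE; exact: (life_stage L).
- by move=> /UE[h _] /UE[h' _]; exact: (life_using L h h').
- by move=> /UE[h zv]; rewrite inE' zv; exact: (life_using_intro L h).
- rewrite inE'; case: (z0 =P v) => [<-|_]; last exact: (life_intro L).
  by rewrite (life_using_intro L uyz).
- rewrite /= dE inE' stE => td h; apply: (life_live L td); case: h => [|[u /UE[h _]]].
    by case: (z0 =P v) => [<- _|_]; [right; exists y0 | left].
  by right; exists u.
- rewrite insE fE H // => ins /andP[av _] /SE[n' sn ->] /RE rn.
  by have := life_sent L ins av sn rn; lia.
- rewrite insE fE in_send andbC /= => ins rv /RE rn.
  have := life_release L ins rv rn; have := @release_gt0 k _ _ rv; have := life_stage L v.
  case: eqP => [->|//]; rewrite /stage /= ay0; lia.
- rewrite insE fE pE => ins pv /SE[n' sn ->] /RE rn.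
  have [-> e] := life_pend L ins pv sn rn; have := life_stage L v.
  case: eqP pv => [->|_]; last by rewrite e.
  by rewrite /stage /= ay0; lia.
Qed.

(** The announcement of [z] turns from a message into a fact, and on [y] one message moves from in
    flight to the receive count. *)
Lemma life_info al mu rho chi Phi y (z : token) (B C : actor) :
  let k := Config al mu rho chi in
  wf k -> life k ->
  al.[? C] = Some (Idle Phi) ->
  InfoMsg y (Refob z B C) B \in mu C ->
  life (Config al.[C <- Idle (Created (Refob z B C) |` IncRecv y Phi)]
         (consume mu C (InfoMsg y (Refob z B C) B)) rho chi).
Proof.
move=> k W L alC; set z0 := Refob z B C => yzC.
move e' : al.[C <- _] => al'; set mu' := consume _ _ _; pose k' := Config al' mu' rho chi.
have knC := knE alC; have [[ty _ _] _] := wf_msg W yzC.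
have dE : domf al' = domf al by rewrite -e' (domf_set _ alC).
have insE v : inside k' v = inside k v by rewrite /inside /= dE.
have H f : ~~ is_count f -> holds al' f = holds al f || (f == Created z0).
  move=> nc.
  rewrite -e' (holds_set (del := pred0) (add := pred1 (Created z0)) alC) ?andbT //=.
    by rewrite in_fset1U mem_IncRecv ?andbT 1?orbC //; case: f nc.
  by move/eqP->.
have RE v n : recv k' v n -> exists2 m, recv k v m & n = m + (v == y).
  rewrite /recv /= -e' kn_set; case: eqP => [->|nC] sn.
    rewrite knC; apply: derives_IncRecv; apply: derives_recv_eq sn => m.
    by rewrite in_fset1U.
  by exists n => //; case: eqP nC => [->|] //; rewrite addn0.
have SE v n : sent k' v n -> sent k v n.
  apply: (@sent_set k k' _ _ _ _ _ alC (esym e')) => m /=.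
  by rewrite in_fset1U mem_IncRecv.
have pE v : pend k' v = pend k v by rewrite /pend /= (count_consume _ _ yzC) andbF.
have stE v : stage k' v = stage k v.
  by rewrite /stage pE /relm /= (count_consume _ _ yzC) andbF !H // !fact_eqE !orbF.
have inE' v : intro k' v = intro k v.
  (* By [life_intro] the fact was not recorded while the Info message was in transit, so the sum is
     unchanged. *)
  have := life_intro L v; rewrite /intro /infm /= (count_consume _ _ yzC) H // fact_eqE /=.
  by rewrite [z0 == v]eq_sym; case: (v =P z0) => [->|_]; rewrite /= ?eqxx ?andbF ?orbF ?orbT /= -/mu'; lia.
have fE v : infl k v = (v == y) + infl k' v.
  rewrite /infl /= (count_consume _ _ yzC) /= [y == v]eq_sym.
  by case: (v =P y) => [->|_]; rewrite ?andbF // ty eqxx.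
have UE u v : holds al' (CreatedUsing u v) = holds al (CreatedUsing u v).
  by rewrite H // fact_eqE orbF.
rewrite -/k'; split=> [v|u u' v|u v|v|v|v n m|v n m|v n m].
- rewrite stE; exact: (life_stage L).
- rewrite !UE; exact: (life_using L).
- rewrite UE inE'; exact: (life_using_intro L).
- rewrite inE'; exact: (life_intro L).
- rewrite /= dE inE' stE => td h; apply: (life_live L td).
  by case: h => [|[u]]; [left | rewrite UE; right; exists u].
- rewrite insE H // fact_eqE orbF => ins av /SE sn /RE[m' rn ->].
  by have := life_sent L ins av sn rn; rewrite fE; lia.
- rewrite insE => ins /in_consume rv /RE[m' rn ->].
  by have := life_release L ins rv rn; rewrite fE; lia.
- rewrite insE pE => ins pv /SE sn /RE[m' rn ->].
  by have := life_pend L ins pv sn rn; rewrite fE; lia.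
Qed.

(** The stage moves from activated to a Release message, and [life_sent] becomes [life_release] for
    the count it carries. Afterwards [x] is neither activated nor pending, so no clause refers to
    its erased send count. *)
Lemma life_send_release al mu rho chi Phi (x : token) n (A B : actor) :
  let k := Config al mu rho chi in
  wf k -> life k ->
  al.[? A] = Some (Busy Phi) ->
  derives Phi (Activated (Refob x A B)) ->
  derives Phi (SentCount (Refob x A B) n) ->
  life (Config
         al.[A <- Busy (Phi `\` [fset Activated (Refob x A B);
                                      SentCount (Refob x A B) n])]
         (send mu B (ReleaseMsg (Refob x A B) n)) rho chi).
Proof.
move=> k W L alA; set x0 := Refob x A B => dx dn.
move e' : al.[A <- _] => al'; set mu' := send _ _ _; pose k' := Config al' mu' rho chi.
have knA := knE alA.
have ax0 : holds al (Activated x0) by rewrite /holds /= knA (derives_activated dx).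
have dE : domf al' = domf al by rewrite -e' (domf_set _ alA).
have insE v : inside k' v = inside k v by rewrite /inside /= dE.
have H f : ~~ is_count f -> holds al' f = holds al f && (f != Activated x0).
  move=> nc.
  rewrite -e' (holds_set (del := pred1 (Activated x0)) (add := pred0) alA) ?orbF //=.
    rewrite in_fsetD !fset_memE negb_or andbC.
    by have /negPf-> : f != SentCount x0 n; [apply: contraNneq nc => -> | rewrite andbT].
  by move/eqP->.
have SE v m : v != x0 -> sent k' v m -> sent k v m.
  move=> vx; rewrite /sent /= -e' kn_set; case: eqP => [->|//].
  rewrite knA; apply: derives_sent_eq => i /=.
  rewrite in_fsetD !fset_memE /=; case: eqP => [[vx']|_] //.
  by rewrite vx' eqxx in vx.
have RE v m : recv k' v m -> recv k v m.
  apply: (@recv_set k k' _ _ _ _ _ alA (esym e')) => i /=.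
  by rewrite in_fsetD !fset_memE.
have pE v : pend k' v = pend k v by rewrite /pend /= count_send andbF.
have stE v : stage k' v = stage k v.
  rewrite /stage pE /relm /= count_send !H // !fact_eqE !andbT /= [x0 == v]eq_sym.
  by case: (v =P x0) => [->|_]; rewrite /= ?eqxx ?ax0 ?andbF ?andbT /=; lia.
have inE' v : intro k' v = intro k v.
  by rewrite /intro /infm /= count_send H // fact_eqE andbT andbF.
have fE v : infl k' v = infl k v by rewrite /infl /= count_send andbF.
have UE u v : holds al' (CreatedUsing u v) = holds al (CreatedUsing u v).
  by rewrite H // fact_eqE andbT.
have px0 : pend k x0 = 0 by have := life_stage L x0; rewrite /stage /= ax0; lia.
rewrite -/k'; split=> [v|u u' v|u v|v|v|v m1 m|v m1 m|v m1 m].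
- rewrite stE; exact: (life_stage L).
- rewrite !UE; exact: (life_using L).
- rewrite UE inE'; exact: (life_using_intro L).
- rewrite inE'; exact: (life_intro L).
- rewrite /= dE inE' stE => td h; apply: (life_live L td).
  by case: h => [|[u]]; [left | rewrite UE; right; exists u].
- rewrite insE H // fE fact_eqE => ins /andP[av vx] /(SE _ _ vx) sn /RE rn.
  exact: (life_sent L ins av sn rn).
- rewrite insE fE in_send => ins /orP[/andP[_ /eqP[vx ->]]|rv] /RE rn; last first.
    exact: (life_release L ins rv rn).
  rewrite vx in ins rn *; apply: (life_sent L ins ax0 _ rn).
  by rewrite /sent /= knA.
- rewrite insE pE fE => ins pv sn /RE rn; apply: (life_pend L ins pv _ rn).
  by apply: SE sn; apply: contraTneq pv => ->; rewrite px0.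
Qed.

Lemma life_release_delivery al mu rho chi Phi (x : token) n (A B : actor) :
  let k := Config al mu rho chi in
  life k ->
  al.[? B] = Some (Idle Phi) ->
  ReleaseMsg (Refob x A B) n \in mu B ->
  life (Config al.[B <- Idle (Released (Refob x A B) |` Phi)]
         (consume mu B (ReleaseMsg (Refob x A B) n)) rho chi).
Proof.
move=> k L alB; set x0 := Refob x A B => xB.
move e' : al.[B <- _] => al'; set mu' := consume _ _ _; pose k' := Config al' mu' rho chi.
have dE : domf al' = domf al by rewrite -e' (domf_set _ alB).
have insE v : inside k' v = inside k v by rewrite /inside /= dE.
have H f : ~~ is_count f -> holds al' f = holds al f || (f == Released x0).
  move=> nc.
  rewrite -e' (holds_set (del := pred0) (add := pred1 (Released x0)) alB) ?andbT //=.
    by rewrite in_fset1U ?andbT 1?orbC.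
  by move/eqP->.
have RE v m : recv k' v m -> recv k v m.
  apply: (@recv_set k k' _ _ _ _ _ alB (esym e')) => i /=.
  by rewrite !fset_memE.
have SE v m : sent k' v m -> sent k v m.
  apply: (@sent_set k k' _ _ _ _ _ alB (esym e')) => i /=.
  by rewrite !fset_memE.
have pE v : pend k' v = pend k v by rewrite /pend /= (count_consume _ _ xB) andbF.
have stE v : stage k' v = stage k v.
  (* The bound shows that the release was not yet recorded, so trading the message for the fact
     keeps the sum. *)
  have := life_stage L v.
  rewrite /stage pE /relm /= (count_consume _ _ xB) !H // !fact_eqE /= [x0 == v]eq_sym.
  by case: (v =P x0) => [->|_]; rewrite /= ?eqxx ?andbF ?orbF ?orbT /= -/mu'; lia.
have inE' v : intro k' v = intro k v.
  by rewrite /intro /infm /= (count_consume _ _ xB) H // fact_eqE orbF andbF.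
have fE v : infl k' v = infl k v by rewrite /infl /= (count_consume _ _ xB) andbF.
have UE u v : holds al' (CreatedUsing u v) = holds al (CreatedUsing u v).
  by rewrite H // fact_eqE orbF.
rewrite -/k'; split=> [v|u u' v|u v|v|v|v i m|v i m|v i m].
- rewrite stE; exact: (life_stage L).
- rewrite !UE; exact: (life_using L).
- rewrite UE inE'; exact: (life_using_intro L).
- rewrite inE'; exact: (life_intro L).
- rewrite /= dE inE' stE => td h; apply: (life_live L td).
  by case: h => [|[u]]; [left | rewrite UE; right; exists u].
- by rewrite insE H // fE fact_eqE orbF => ins av /SE sn /RE; exact: (life_sent L ins av sn).
- by rewrite insE fE => ins /in_consume rv /RE; exact: (life_release L ins rv).
- by rewrite insE pE fE => ins pv /SE sn /RE; exact: (life_pend L ins pv sn).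
Qed.

(** Here [x] leaves its life cycle. Released was its only stage, and [life_intro] with
    [life_using_intro] leaves no other record of its creation, so [life_live] and the count clauses
    hold vacuously for [x]. *)
Lemma life_compaction al mu rho chi Phi (x : token) (B C : actor) :
  let k := Config al mu rho chi in
  life k ->
  al.[? C] = Some (Idle Phi) ->
  Created (Refob x B C) \in Phi -> Released (Refob x B C) \in Phi ->
  life (Config
         al.[C <- Idle [fset f in Phi |
                          [&& f != Created (Refob x B C),
                              f != Released (Refob x B C)
                            & ~~ is_recv (Refob x B C) f]]]
         mu rho chi).
Proof.
move=> k L alC; set x0 := Refob x B C => cP rP.
move e' : al.[C <- _] => al'; pose k' := Config al' mu rho chi.
have knC := knE alC.
have cx0 : holds al (Created x0) by rewrite /holds /= knC.
have rx0 : holds al (Released x0) by rewrite /holds /= knC.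
have dE : domf al' = domf al by rewrite -e' (domf_set _ alC).
have insE v : inside k' v = inside k v by rewrite /inside /= dE.
have H f : ~~ is_count f ->
    holds al' f = holds al f && ~~ ((f == Created x0) || (f == Released x0)).
  move=> nc; rewrite -e' (holds_set (add := pred0) alC
    (del := fun f => (f == Created x0) || (f == Released x0))) ?orbF //=.
    rewrite !inE negb_or; have -> : is_recv x0 f = false by case: f nc.
    by rewrite andbT.
  by case/orP=> /eqP->.
have RE v m : v != x0 -> recv k' v m -> recv k v m.
  move=> vx; rewrite /recv /= -e' kn_set; case: eqP => [->|//].
  rewrite knC; apply: derives_recv_eq => i /=.
  by rewrite !inE /= (negPf vx) !andbT.
have SE v m : sent k' v m -> sent k v m.
  apply: (@sent_set k k' _ _ _ _ _ alC (esym e')) => i /=.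
  by rewrite !inE !andbT.
have stE v : stage k v = (v == x0) + stage k' v.
  rewrite /stage /relm /= !H // !fact_eqE /=.
  case: (v =P x0) => [->|_]; rewrite /= ?rx0 ?andbT ?andbF /=; last by [].
  by rewrite addn0 add1n addn1.
have inE' v : intro k v = (v == x0) + intro k' v.
  rewrite /intro /infm /= !H // !fact_eqE /= orbF.
  case: (v =P x0) => [->|_]; rewrite /= ?cx0 ?andbT ?andbF /=; last by [].
  by rewrite addn0 add1n addn1.
have UE u v : holds al' (CreatedUsing u v) = holds al (CreatedUsing u v).
  by rewrite H // !fact_eqE andbT.
have st0 : stage k' x0 = 0 by have := life_stage L x0; rewrite stE eqxx; lia.
rewrite -/k'; split=> [v|u u' v|u v|v|v|v i m|v i m|v i m].
- by have := life_stage L v; rewrite stE; lia.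
- rewrite !UE; exact: (life_using L).
- by rewrite UE => /(life_using_intro L); rewrite inE'; lia.
- by have := life_intro L v; rewrite inE'; lia.
- rewrite /= dE => td h; have := life_live L td; rewrite stE.
  case: (v =P x0) h => [->|_] h.
    case: h => [h|[u]]; first by have := life_intro L x0; rewrite inE' eqxx; lia.
    by rewrite UE => /(life_using_intro L); rewrite inE' eqxx.
  apply; case: h => [h|[u]]; first by left; rewrite inE'; lia.
  by rewrite UE; right; exists u.
- rewrite insE => ins av /SE sn rn.
  have vx : v != x0.
    by apply: contraTneq av => vx; have := st0; rewrite vx /stage /=; lia.
  by rewrite H // in av; case/andP: av => av _; exact: (life_sent L ins av sn (RE _ _ vx rn)).
- rewrite insE => ins rv rn.
  have vx : v != x0.
    have := @release_gt0 k' _ _ rv; apply: contraTneq => vx.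
    by have := st0; rewrite vx /stage /=; lia.
  exact: (life_release L ins rv (RE _ _ vx rn)).
- rewrite insE => ins pv /SE sn rn.
  have vx : v != x0.
    by apply: contraTneq pv => vx; have := st0; rewrite vx /stage /=; lia.
  exact: (life_pend L ins pv sn (RE _ _ vx rn)).
Qed.

(** The refob [x] is owned outside, hence not [inside] and exempt from the count clauses; the refobs
    in [R] are fresh and become pending. *)
Lemma life_in al mu rho chi x (A : actor) R chi' :
  let k := Config al mu rho chi in
  life k -> target x = A -> owner x \notin domf al ->
  (forall r, r \in R -> [/\ owner r = A, fresh_token k (rtoken r)
                          & rtoken r <> rtoken x]) ->
  life (Config al (send mu A (AppMsg x R)) rho chi').
Proof.
move=> k L tx ox hR; set mu' := send _ _ _; pose k' := Config al mu' rho chi'.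
have Rfresh v : v \in R -> ~ occurs k v by move=> /hR[_ fv _] /fv.
have pE v : pend k' v = (v \in R) + pend k v.
  rewrite /pend /= count_send /=; case: (boolP (v \in R)) => vR; last by rewrite andbF.
  by have [-> _ _] := hR v vR; rewrite eqxx.
have stE v : stage k' v = (v \in R) + stage k v.
  by rewrite /stage pE /relm /= count_send andbF add0n !addnA.
have inE' v : intro k' v = intro k v by rewrite /intro /infm /= count_send andbF.
have fE v : v != x -> infl k' v = infl k v.
  by move=> /negPf vx; rewrite /infl /= count_send /= [x == v]eq_sym vx andbF.
have ne v : inside k v -> v != x.
  by apply: contraTneq => ->; rewrite /inside /= (negPf ox).
rewrite -/k'; split=> [v|u u' v|u v|v|v|v i m|v i m|v i m].
- rewrite stE; case: (boolP (v \in R)) => [/Rfresh/absent[-> _ _ _]//|_].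
  exact: (life_stage L).
- exact: (life_using L).
- rewrite inE'; exact: (life_using_intro L).
- rewrite inE'; exact: (life_intro L).
- rewrite inE' stE => td h; case: (life_live L td h) => [|?]; last by right.
  by left; lia.
- by move=> ins; rewrite (fE _ (ne _ ins)); exact: (life_sent L).
- by move=> ins; rewrite (fE _ (ne _ ins)) in_send andbC /=; exact: (life_release L).
- move=> ins; rewrite (fE _ (ne _ ins)) pE; case: (boolP (v \in R)) => [vR _|_].
    by move=> sn rn; have [_ _ _ /(_ _ _ sn rn)[-> -> ->]] := absent (Rfresh _ vR).
  exact: (life_pend L).
Qed.

(* Losing a message to an external actor [B]: only refobs held by [B], or
   having [B] as target, are concerned. *)
Lemma life_drop al mu rho rho' chi (B : actor) m :
  let k := Config al mu rho chi in
  wf k -> life k -> B \in chi -> m \in mu B -> {subset rho <= rho'} ->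
  (forall x, app_carrying x m -> target x \in domf al -> target x \in rho') ->
  life (Config al (consume mu B m) rho' chi).
Proof.
move=> k W L Bchi mB sub hrho.
have Bd : B \notin domf al := wf_disjoint W Bchi.
have own v : app_carrying v m -> owner v = B.
  by have [] := wf_msg W mB; clear; case: m => // y R [_ oR] _ /oR.
move em : (consume _ _ _) => mu'; pose k' := Config al mu' rho' chi.
have cE C p : count p (mu C) = ((C == B) && p m) + count p (mu' C).
  by rewrite -em (count_consume _ _ mB).
(* An internal target differs from [B], so its mailbox is untouched. *)
have outF v p : target v \in domf al ->
    count p (mu (target v)) = count p (mu' (target v)).
  by move=> td; rewrite cE //; case: eqP => // tB; rewrite tB (negPf Bd) in td.
have pendF v : pend k v = app_carrying v m + pend k' v.
  rewrite /pend /= cE //; case: (boolP (app_carrying v m)) => [/own->|_].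
    by rewrite eqxx.
  by rewrite andbF.
have le p C : count p (mu' C) <= count p (mu C) by rewrite cE // leq_addl.
have leR v : relm k' v <= relm k v by apply: le.
have leI v : intro k' v <= intro k v by rewrite /intro leq_add2r; apply: le.
rewrite -/k'; split=> [v|u u' v|u v|v|v|v i n|v i n|v i n].
- have := life_stage L v; rewrite /stage pendF /=.
  by have := leR v; lia.
- exact: (life_using L).
- by move=> /(life_using_intro L); have := leI v; lia.
- by have := life_intro L v; have := leI v; lia.
- move=> td h; have h' : 0 < intro k v \/ exists u, holds al (CreatedUsing u v).
    by move: h; rewrite /intro /infm /= -outF.
  case: (life_live L td h') => [|/andP[od /sub tr]]; last by right; rewrite /= od tr.
  rewrite /stage pendF /relm /= outF //.
  case: (boolP (app_carrying v m)) => [vm _|_]; last by left.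
  (* A refob carried by the lost message passes to the external actor [B], and its target is now a
     receptionist. *)
  right; rewrite /= (hrho _ vm td) andbT.
  by rewrite (own v vm).
- move=> /andP[od td]; rewrite /infl /= -outF //; apply: (life_sent L).
  by rewrite /inside od.
- move=> /andP[od td]; rewrite /infl /= -outF // -em => /in_consume.
  by apply: (life_release L); rewrite /inside od.
- move=> /andP[od td]; rewrite /infl /= -outF // => pv; apply: (life_pend L).
    by rewrite /inside od.
  by rewrite pendF; lia.
Qed.

Record drl_inv k : Prop := DrlInv { inv_wf : wf k; inv_life : life k }.

Lemma inv_initial k : initial k -> drl_inv k.
Proof. by move=> i; split; [apply: wf_initial | apply: life_initial]. Qed.

Lemma inv_step k ev k' : drl_inv k -> step k ev k' -> drl_inv k'.
Proof.
case=> W L st; split; first exact: wf_step W st.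
move: W L; case: st => {k ev k'}.
- by move=> *; apply: life_spawn.
- by move=> *; apply: life_send.
- by move=> *; apply: life_receive.
- by move=> *; apply: life_idle.
- by move=> *; apply: life_send_info.
- by move=> *; apply: life_info.
- by move=> *; apply: life_send_release.
- by move=> al mu rho chi Phi x n A B alB xB _ _ L; apply: life_release_delivery L alB xB.
- by move=> *; apply: life_compaction.
- by [].
- move=> al mu rho chi x A R k Arho tx ox hR _ _ L.
  by apply: (life_in _ L) => // r /hR[].
- move=> al mu rho chi x B R Bchi xB W L.
  apply: (life_drop W L Bchi xB) => [C|v /= vR td]; rewrite !inE; first by move->.
  by apply/orP; right; rewrite td andbT; apply/imfsetP; exists v.
- by move=> al mu rho chi x n B Bchi xB W L; apply: (life_drop W L Bchi xB).
- by move=> al mu rho chi y z A B Bchi xB W L; apply: (life_drop W L Bchi xB).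
Qed.


Lemma domf_someP al A : A \in domf al -> exists s, al.[? A] = Some s.
Proof. by rewrite -fndSome; case: (al.[? A]) => // s _; exists s. Qed.

(** * Quiet actors *)

(** This makes the refob of a Release message to an internal actor [inside], so that [life_release]
    applies. It persists because senders of Release messages are internal and the domain only
    grows. *)
Definition release_owner k : Prop := forall B x n,
  ReleaseMsg x n \in undelivered k B -> owner x \in domf (internal k).

Lemma domf_step k ev k' : step k ev k' -> {subset domf (internal k) <= domf (internal k')}.
Proof.
by case=> {k ev k'} * C Cd //=; rewrite ?dom_setf ?in_fset1U Cd ?orbT.
Qed.

Lemma release_owner_step k ev k' : step k ev k' -> release_owner k -> release_owner k'.
Proof.
move=> st ro C y i yi; apply: (domf_step st); move: C y i yi ro; case: st => {k ev k'}.
- by move=> al mu rho chi Phi x y A B k _ _ _ _ _ C v i /= vi /(_ _ _ _ vi).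
- move=> al mu rho chi Phi x l A B k _ _ _ _ C v i.
  by rewrite /= in_send andbC /= => vi /(_ _ _ _ vi).
- by move=> al mu rho chi Phi x B R _ _ C v i /in_consume vi /(_ _ _ _ vi).
- by move=> al mu rho chi Phi A _ C v i /= vi /(_ _ _ _ vi).
- move=> al mu rho chi Phi y z A B D _ _ C v i.
  by rewrite /= in_send andbC /= => vi /(_ _ _ _ vi).
- by move=> al mu rho chi Phi y z B D _ _ C v i /in_consume vi /(_ _ _ _ vi).
- move=> al mu rho chi Phi x n A B alA _ _ _ C v i.
  rewrite /= in_send => /orP[/andP[_ /eqP[-> _ _]]|vi /(_ _ _ _ vi)//].
  exact: domf_some alA.
- by move=> al mu rho chi Phi x n A B _ _ _ C v i /in_consume vi /(_ _ _ _ vi).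
- by move=> al mu rho chi Phi x B D _ _ _ C v i /= vi /(_ _ _ _ vi).
- by move=> al mu rho chi Phi A _ C v i /= vi /(_ _ _ _ vi).
- move=> al mu rho chi x A R k _ _ _ _ _ C v i.
  by rewrite /= in_send andbC /= => vi /(_ _ _ _ vi).
- by move=> al mu rho chi x B R _ _ C v i /in_consume vi /(_ _ _ _ vi).
- by move=> al mu rho chi x n B _ _ C v i /in_consume vi /(_ _ _ _ vi).
- by move=> al mu rho chi y z A B _ _ C v i /in_consume vi /(_ _ _ _ vi).
Qed.

(** Only an application message wakes an idle actor, and only a busy owner can give up an
    activation. *)
Lemma idle_step k ev k' B Phi : (internal k).[? B] = Some (Idle Phi) -> step k ev k' ->
  exists s, [/\ (internal k').[? B] = Some s,
    forall x, Activated x \in Phi -> Activated x \in knowledge_of s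
    & (exists Psi, s = Busy Psi) -> exists x R, AppMsg x R \in undelivered k B].
Proof.
move=> kB st; move: kB; case: st => {k ev k'}; cbn beta iota delta [internal undelivered].
- move=> al mu rho chi Psi x y A C k alA _ _ _ [Cd _ _] alB; exists (Idle Phi).
  split=> // [|[]//]; rewrite !fnd_set; case: eqP => [BC|_].
    by case/negP: Cd; rewrite -BC; apply: domf_some alB.
  by case: eqP => // BA; move: alA; rewrite -BA alB.
- move=> al mu rho chi Psi x l A C k alA _ _ _ alB; exists (Idle Phi); split=> // [|[]//].
  by rewrite fnd_set; case: eqP => // BA; move: alA; rewrite -BA alB.
- move=> al mu rho chi Psi x C R alC xC alB; rewrite fnd_set; case: eqP => [BC|_].
    rewrite -BC alB in alC; case: alC => PP; rewrite BC in alB *.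
    eexists; split=> [//|z zP /=|_]; last by exists x, R.
    by rewrite in_fsetU mem_IncRecv // -PP zP.
  by exists (Idle Phi); split=> // -[].
- move=> al mu rho chi Psi A alA alB; exists (Idle Phi); split=> // [|[]//].
  by rewrite fnd_set; case: eqP => // BA; move: alA; rewrite -BA alB.
- move=> al mu rho chi Psi y z A C D alA _ alB; exists (Idle Phi); split=> // [|[]//].
  by rewrite fnd_set; case: eqP => // BA; move: alA; rewrite -BA alB.
- move=> al mu rho chi Psi y z C D alD _ alB; rewrite fnd_set; case: eqP => [BD|_].
    rewrite -BD alB in alD; case: alD => PP; eexists; split=> [//|v vP /=|[]//].
    by rewrite in_fset1U mem_IncRecv // -PP vP.
  by exists (Idle Phi); split=> // -[].
- move=> al mu rho chi Psi x n A C alA _ _ _ alB; exists (Idle Phi); split=> // [|[]//].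
  by rewrite fnd_set; case: eqP => // BA; move: alA; rewrite -BA alB.
- move=> al mu rho chi Psi x n A C alC _ _ alB; rewrite fnd_set; case: eqP => [BC|_].
    rewrite -BC alB in alC; case: alC => PP; eexists; split=> [//|v vP /=|[]//].
    by rewrite in_fset1U -PP vP orbT.
  by exists (Idle Phi); split=> // -[].
- move=> al mu rho chi Psi x C D alD _ _ alB; rewrite fnd_set; case: eqP => [BD|_].
    rewrite -BD alB in alD; case: alD => PP; eexists; split=> [//|v vP /=|[]//].
    by rewrite !inE -PP vP.
  by exists (Idle Phi); split=> // -[].
all: by move=> *; exists (Idle Phi); split=> // -[].
Qed.

(** Weaker than termination: Info and Release messages may still be in transit. In this form the
    property passes from the target of an activated refob to its owner. *)
Definition quiet k (B : actor) : Prop :=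
  forall s k', steps k s k' -> exists Phi, (internal k').[? B] = Some (Idle Phi).

Lemma quiet_idle k B : quiet k B -> exists Phi, (internal k).[? B] = Some (Idle Phi).
Proof. by move/(_ [::] k erefl). Qed.

Lemma quiet_dom k B : quiet k B -> B \in domf (internal k).
Proof. by case/quiet_idle=> Phi; apply: domf_some. Qed.

Lemma quiet_step k ev k' B : quiet k B -> step k ev k' -> quiet k' B.
Proof. by move=> q st s k2 ss; apply: (q (ev :: s)); exists k'. Qed.

(** With a mailbox that stays empty there is no application message to wake the actor. *)
Lemma terminated_quiet e t A : terminated e t A -> quiet (conf_at e t) A.
Proof.
case=> idleA empty s; move: idleA empty.
elim: s (conf_at e t) => [|ev s IH] k [Phi kA] empty k' /=; first by move<-; exists Phi.
case=> k1 st; have [s1 [k1A _ busy]] := idle_step kA st; apply: IH.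
  case: s1 k1A busy => [Psi|Psi] k1A busy; last by exists Psi.
  have [|x [R]] := busy; first by exists Psi.
  by rewrite (empty [::] k erefl) in_mset0.
by move=> s2 k2 ss; apply: (empty (ev :: s2)); exists k1.
Qed.

Lemma quiet_app k B x R : quiet k B -> AppMsg x R \notin undelivered k B.
Proof.
case: k => al mu rho chi q; apply/negP => /= xB; have [Phi /= alB] := quiet_idle q.
have [Psi] := quiet_idle (quiet_step q (step_receive rho chi alB xB)).
by cbn [internal]; rewrite fnd_set eqxx.
Qed.

(** A busy owner could send an application message without refobs, against [quiet_app]. *)
Lemma quiet_held k A Phi x : quiet k (target x) -> (internal k).[? A] = Some (Busy Phi) ->
  owner x = A -> Activated x \notin Phi.
Proof.
case: k => al mu rho chi; case: x => x A' B /= q alA AA; rewrite AA; apply/negP => xP.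
have st := @step_send al mu rho chi Phi x [::] A B alA (derives_mem xP).
have {}st := st (fun _ _ _ => ltac:(by [])) isT.
have := quiet_step q st => /quiet_app /=; rewrite /send /= => /(_ (Refob x A B)).
move/(_ [fset Refob p.1.2 B p.2 | p in ([::] : seq (nat * nat * nat))]).
by rewrite eqxx in_msetD in_mset1 eqxx orbT.
Qed.

Lemma fresh_nat (D : {fset nat}) : exists E, E \notin D.
Proof.
exists (\max_(i <- D) i).+1; apply/negP => h.
by have := @leq_bigmax_seq _ (enum_fset D) xpredT id _ h isT; rewrite ltnn.
Qed.

(** A receptionist could get an empty application message from outside. The token 0 is arbitrary;
    what matters is an owner [E] that is not internal. *)
Lemma quiet_receptionist k B : quiet k B -> B \notin receptionists k.
Proof.
case: k => al mu rho chi q; apply/negP => /= Brho; have [E nE] := fresh_nat (domf al).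
have st := @step_in al mu rho chi (Refob 0 E B) B fset0 Brho erefl nE.
have /(@quiet_app _ _ (Refob 0 E B) fset0) := quiet_step q (st (fun _ => ltac:(by [])) (fun _ _ => ltac:(by []))).
by rewrite /= in_send !eqxx.
Qed.

(** An internal owner, made idle if necessary, could receive the message and be busy with [x]
    activated, against [quiet_held]. An external owner could consume it and make the target a
    receptionist, against [quiet_receptionist]. *)
Lemma quiet_pend k x : wf k -> quiet k (target x) -> pend k x = 0.
Proof.
move=> W q; apply/eqP; rewrite -leqn0 leqNgt; apply/mset_has_count => -[[]] // y R yA /= xR.
have [[ty oR] kn] := wf_msg W yA; have := kn y (mem_head _ _); rewrite ty.
case: k W q yA kn => al mu rho chi W q yA kn /orP[/= Ad|/= Achi].
  have [k1 [q1 [Phi [k1A y1A]]]] : exists k1, quiet k1 (target x) /\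
      exists Phi, (internal k1).[? owner x] = Some (Idle Phi) /\
        AppMsg y R \in undelivered k1 (owner x).
    have [[Phi|Phi] alA] := domf_someP Ad.
      have st := step_idle mu rho chi alA.
      exists (Config al.[owner x <- Idle Phi] mu rho chi); split; first exact: quiet_step q st.
      by exists Phi; cbn [internal]; rewrite fnd_set eqxx.
    by exists (Config al mu rho chi); split=> //; exists Phi.
  case: k1 q1 k1A y1A => al1 mu1 rho1 chi1 q1 k1A y1A.
  have := quiet_held (quiet_step q1 (step_receive rho1 chi1 k1A y1A)) _ erefl.
  move=> /(_ _ ltac:(cbn [internal]; rewrite fnd_set eqxx; reflexivity)).
  by rewrite in_fsetU negb_or => /andP[_ /imfsetP[]]; exists x.
have := quiet_receptionist (quiet_step q (step_out al rho Achi yA)).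
rewrite /= in_fsetU in_fsetI negb_or (quiet_dom q) andbT => /andP[_ /imfsetP[]].
by exists x.
Qed.

(** By [quiet_held] the owner is idle now, and by [idle_step] an idle owner keeps [x] activated
    through any step; the argument repeats along every path. *)
Lemma quiet_owner k x : quiet k (target x) -> holds (internal k) (Activated x) ->
  quiet k (owner x).
Proof.
move=> q h s; elim: s k q h => [|ev s IH] k q h k' /= ss.
  subst k'; move: h; rewrite /holds /= /kn; case e : (_.[? _]) => [[Phi|Phi]|//] /=.
    by rewrite (negPf (quiet_held q e erefl)).
  by exists Phi.
case: ss => k1 st; apply: IH; first exact: quiet_step q st.
move: h; rewrite /holds /= {1}/kn; case e : (_.[? _]) => [[Phi|Phi]|//] /= h.
  by rewrite (negPf (quiet_held q e erefl)) in h.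
by have [s1 [e1 /(_ _ h) h1 _]] := idle_step e st; rewrite (knE e1).
Qed.

(** * Mailboxes and incoming refobs of quiet actors *)

Lemma size_consume mu B m : m \in mu B ->
  (size (consume mu B m B) < size (mu B)).
Proof.
by move=> mB; rewrite -!count_predT (count_consume _ _ mB) eqxx add1n.
Qed.

Lemma send_other mu B m C : C != B -> send mu B m C = mu C.
Proof. by rewrite /send /= => /negPf->. Qed.

Lemma consume_or mu C m B : m \in mu C ->
  consume mu C m B = mu B \/ size (consume mu C m B) < size (mu B).
Proof.
have [->|nBC] := eqVneq B C; first by move/size_consume; right.
by move=> _; left; rewrite /consume /= (negPf nBC).
Qed.

(** Nothing can be sent to a quiet actor: an application message would contradict [quiet_app] after
    the step, and Info and Release messages come from busy owners of activated refobs, against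
    [quiet_held]. *)
Lemma quiet_mail k ev k' B : wf k -> quiet k B -> step k ev k' ->
  undelivered k' B = undelivered k B \/
  size (undelivered k' B) < size (undelivered k B).
Proof.
move=> W q st; move: W q (quiet_step q st).
case: st => {k ev k'}; cbn beta iota delta [internal undelivered].
- by left.
- move=> al mu rho chi Phi x l A C k alA _ _ _ _ _ q'; left; apply: send_other.
  have := @quiet_app _ _ (Refob x A C) [fset Refob p.1.2 C p.2 | p in l] q'.
  by rewrite /= in_send eqxx andbT negb_or => /andP[].
- by move=> *; apply: consume_or.
- by left.
- move=> al mu rho chi Phi y z A D C alA yzP W q _; left; apply: send_other.
  apply/eqP => BC; have [_] := wf_using_in W alA yzP; rewrite BC in q.
  by rewrite /= (negPf (@quiet_held _ _ _ (Refob y A C) q alA erefl)).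
- by move=> *; apply: consume_or.
- move=> al mu rho chi Phi x n A C alA /derives_activated xP _ _ _ q _; left; apply: send_other.
  apply/eqP => BC; rewrite BC in q.
  by rewrite (negPf (@quiet_held _ _ _ (Refob x A C) q alA erefl)) in xP.
- by move=> *; apply: consume_or.
- by left.
- by left.
- move=> al mu rho chi x A R k _ _ _ _ _ _ _ q'; left; apply: send_other.
  have := @quiet_app _ _ x R q'.
  by rewrite /= in_send eqxx andbT negb_or => /andP[].
- by move=> *; apply: consume_or.
- by move=> *; apply: consume_or.
- by move=> *; apply: consume_or.
Qed.

Definition control_recipient (ev : event) : actor :=
  match ev with EvInfo _ _ _ C => C | EvRelease _ _ B => B | _ => 0 end.

Lemma control_delivery_mail k ev k' : is_control_delivery ev -> step k ev k' ->
  size (undelivered k' (control_recipient ev)) < size (undelivered k (control_recipient ev)).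
Proof. by move=> c st; case: st c => //= *; apply: size_consume. Qed.

(** Activations arise only from Spawn, towards a new actor, and from Receive, for pending refobs.
    Both are excluded when the target is quiet. *)
Lemma activated_step k ev k' x : wf k -> step k ev k' ->
  holds (internal k') (Activated x) ->
  [\/ holds (internal k) (Activated x), target x \notin domf (internal k) | 0 < pend k x].
Proof.
have upd al A s s' : al.[? A] = Some s ->
    (Activated x \in knowledge_of s' -> Activated x \in knowledge_of s) ->
    holds al.[A <- s'] (Activated x) -> holds al (Activated x).
  move=> alA sub; rewrite /holds kn_set; case: eqP => [->|//].
  by rewrite (knE alA).
move=> W st; move: W; case: st => {k ev k'}; cbn beta iota delta [internal undelivered].
- move=> al mu rho chi Phi u y A B k alA _ _ _ [Bd _ _] _; rewrite /holds !kn_set.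
  case: eqP => [_|_].
    rewrite !fset_memE !fact_eqE /= => /eqP->; by apply: Or32.
  case: eqP => [oA|_]; last by apply: Or31.
  rewrite fset_memE fact_eqE => /predU1P[->|xP]; first by apply: Or32.
  by apply: Or31; rewrite oA (knE alA).
- move=> al mu rho chi Phi u l A B k alA _ _ _ _ h; apply: Or31; apply: upd alA _ h => /=.
  by rewrite in_fsetU mem_IncSent // => /orP[//|/using_setE[a [b [C [_]]]]].
- move=> al mu rho chi Phi u B R alB uB W; rewrite /holds !kn_set.
  case: eqP => [oB|_]; last by apply: Or31.
  rewrite in_fsetU mem_IncRecv // => /orP[xP|/imfsetP[r /= rR [xr]]].
    by apply: Or31; rewrite oB (knE alB).
  apply: Or33; rewrite /pend /= (oB : owner x = B); apply/mset_has_count; exists (AppMsg u R) => //=.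
  by rewrite xr.
- by move=> al mu rho chi Phi A alA _ h; apply: Or31; apply: upd alA _ h.
- move=> al mu rho chi Phi y z A B C alA _ _ h; apply: Or31; apply: upd alA _ h => /=.
  by rewrite mem_IncSent // in_fsetD1 => /andP[].
- move=> al mu rho chi Phi y z B C alC _ _ h; apply: Or31; apply: upd alC _ h => /=.
  by rewrite fset_memE fact_eqE mem_IncRecv.
- move=> al mu rho chi Phi u n A B alA _ _ _ _ h; apply: Or31; apply: upd alA _ h => /=.
  by rewrite in_fsetD => /andP[].
- move=> al mu rho chi Phi u n A B alB _ _ _ h; apply: Or31; apply: upd alB _ h => /=.
  by rewrite fset_memE fact_eqE.
- move=> al mu rho chi Phi u B C alC _ _ _ h; apply: Or31; apply: upd alC _ h => /=.
  by rewrite !inE => /andP[].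
all: by move=> *; apply: Or31.
Qed.

(* The effect on [Phi] of repeated Compaction events. *)
Definition compacted Phi (Psi : knowledge) : Prop :=
  Psi `<=` Phi /\ forall f, f \in Phi -> f \notin Psi ->
    exists x, Released x \in Phi /\
      [\/ f = Created x, f = Released x | exists n, f = RecvCount x n].

Lemma compacted_refl Phi : compacted Phi Phi.
Proof. by split=> // f ->. Qed.

Lemma compacted_trans Phi Psi Xi :
  compacted Phi Psi -> compacted Psi Xi -> compacted Phi Xi.
Proof.
move=> [s1 c1] [s2 c2]; split=> [|f fP fX]; first exact: fsubset_trans s1.
case: (boolP (f \in Psi)) => [fPsi|]; last exact: c1.
by have [x [rx fx]] := c2 f fPsi fX; exists x; split=> //; apply: (fsubsetP s1).
Qed.

(** Compaction erases only three kinds of facts, all about released refobs. Other facts can be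
    carried between a snapshot and a later configuration. *)
Lemma compacted_mem Phi Psi f : compacted Phi Psi ->
  (forall x, Released x \in Phi ->
     [/\ f <> Created x, f <> Released x & forall n, f <> RecvCount x n]) ->
  (f \in Phi) = (f \in Psi).
Proof.
move=> [/fsubsetP sub c] nf; apply/idP/idP => [fP|/sub//].
apply: contraT => /(c f fP)[x [/nf[n1 n2 n3]]].
by case=> [/n1|/n2|[n /n3]].
Qed.

(** An actor becomes idle only by Idle, and an idle one that stays idle changes its knowledge only
    by Info, Release and Compaction. All but the last call for a snapshot. *)
Lemma idle_step_back k ev k' B Psi : step k ev k' ->
  ~ calls_for_snapshot B ev -> (internal k').[? B] = Some (Idle Psi) ->
  exists2 Phi, (internal k).[? B] = Some (Idle Phi) & compacted Phi Psi.
Proof.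
have same al : al.[? B] = Some (Idle Psi) ->
    exists2 Phi, al.[? B] = Some (Idle Phi) & compacted Phi Psi.
  by exists Psi; last exact: compacted_refl.
case=> {k ev k'}; cbn beta iota delta [internal undelivered calls_for_snapshot].
- move=> al mu rho chi Phi x y A C k _ _ _ _ _ _; rewrite !fnd_set.
  by case: eqP => // _; case: eqP => // _; apply: same.
- move=> al mu rho chi Phi x l A C k _ _ _ _ _; rewrite fnd_set; case: eqP => // _; exact: same.
- move=> al mu rho chi Phi x C R _ _ _; rewrite fnd_set; case: eqP => // _; exact: same.
- move=> al mu rho chi Phi A _ nAB; rewrite fnd_set; case: eqP => [/esym //|_]; exact: same.
- move=> al mu rho chi Phi y z A C D _ _ _; rewrite fnd_set; case: eqP => // _; exact: same.
- move=> al mu rho chi Phi y z C D _ _ nDB; rewrite fnd_set; case: eqP => [/esym //|_]; exact: same.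
- move=> al mu rho chi Phi x n A C _ _ _ _ _; rewrite fnd_set; case: eqP => // _; exact: same.
- move=> al mu rho chi Phi x n A C _ _ _ nCB; rewrite fnd_set; case: eqP => [/esym //|_]; exact: same.
- move=> al mu rho chi Phi x C D alD _ rP _; rewrite fnd_set; case: eqP => [->|_]; last exact: same.
  case=> <-; exists Phi => //; split=> [|f fP].
    by apply/fsubsetP => f; rewrite !inE => /andP[].
  rewrite !inE fP /= => nf; exists (Refob x C D); split=> //.
  case: (f =P Created (Refob x C D)) => [|n1]; first by apply: Or31.
  case: (f =P Released (Refob x C D)) => [|n2]; first by apply: Or32.
  move: nf; rewrite /is_recv; case: f {fP} n1 n2 => [v|v|v w|v|v|v n|v n] n1 n2;
    rewrite ?(introF eqP n1) ?(introF eqP n2) //= negbK => /eqP->.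
  by apply: Or33; exists n.
all: by move=> *; apply: same.
Qed.

(** * Executions *)

Lemma exec_step e t : is_execution e ->
  (exists2 ev, event_at e t = Some ev & step (conf_at e t) ev (conf_at e t.+1)) \/
  conf_at e t.+1 = conf_at e t.
Proof.
case=> _ /(_ t); case: (event_at e t) => [ev st|[-> _]]; last by right.
by left; exists ev.
Qed.

Lemma exec_event e t ev : is_execution e -> event_at e t = Some ev ->
  step (conf_at e t) ev (conf_at e t.+1).
Proof. by case=> _ /(_ t) h et; rewrite et in h. Qed.

Lemma exec_inv e t : is_execution e -> drl_inv (conf_at e t).
Proof.
move=> ex; elim: t => [|t IH]; first by case: ex => /inv_initial.
by case: (exec_step t ex) => [[ev _ st]|->//]; apply: inv_step IH st.
Qed.

Lemma exec_release_owner e t : is_execution e -> release_owner (conf_at e t).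
Proof.
move=> ex; elim: t => [|t IH].
  by case: ex => -[A [E [x [y [_ _ ->]]]]] _ B u n; rewrite /= in_mset0.
by case: (exec_step t ex) => [[ev _ st]|->//]; apply: release_owner_step st IH.
Qed.

Lemma exec_quiet e t t' B : is_execution e -> t <= t' ->
  quiet (conf_at e t) B -> quiet (conf_at e t') B.
Proof.
move=> ex; elim: t' => [|t' IH]; first by rewrite leqn0 => /eqP->.
rewrite leq_eqVlt ltnS => /predU1P[<-//|/IH h /h q].
by case: (exec_step t' ex) => [[ev _ st]|->//]; apply: quiet_step q st.
Qed.

(** Going back in time, [activated_step] leaves no room for a new activation towards a target that
    is already quiet. *)
Lemma exec_activated e t t' x : is_execution e -> t <= t' ->
  quiet (conf_at e t) (target x) ->
  holds (internal (conf_at e t')) (Activated x) ->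
  holds (internal (conf_at e t)) (Activated x).
Proof.
move=> ex tt' q; elim: t' tt' => [|t' IH]; first by rewrite leqn0 => /eqP->.
rewrite leq_eqVlt ltnS => /predU1P[<-//|tt' h]; apply: (IH tt').
have q' := exec_quiet ex tt' q.
case: (exec_step t' ex) => [[ev _ st]|<-//].
have W := inv_wf (exec_inv t' ex).
case: (activated_step W st h) => // [|]; first by rewrite (quiet_dom q').
by rewrite (quiet_pend W q').
Qed.

(** Each step keeps the mailbox or shrinks it strictly, so equal sizes force equal mailboxes. *)
Lemma exec_mail_le e t t' B : is_execution e -> t <= t' -> quiet (conf_at e t) B ->
  size (undelivered (conf_at e t') B) <= size (undelivered (conf_at e t) B) ?= iff
    (undelivered (conf_at e t') B == undelivered (conf_at e t) B).
Proof.
move=> ex tt' q; elim: t' tt' => [|t' IH]; first by rewrite leqn0 => /eqP->; apply/leqif_refl.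
rewrite leq_eqVlt ltnS => /predU1P[<-|/[dup] tt' /IH {}IH]; first exact/leqif_refl.
case: (exec_step t' ex) => [[ev _ st]|->//].
case: (quiet_mail (inv_wf (exec_inv t' ex)) (exec_quiet ex tt' q) st) => [->//|lt].
have lt' := leq_trans lt IH; split; first exact: ltnW.
rewrite (ltn_eqF lt'); apply/esym/eqP => e'; by rewrite e' ltnn in lt'.
Qed.

(** Induction on the size of the mailbox: it shrinks later, or it is constant from [t] on. In a
    constant mailbox a control message would stay deliverable, as the recipient is always idle, and
    by fairness its delivery would change the mailbox. *)
Lemma mail_empties e t B : is_execution e -> eventually_delivers_control e ->
  quiet (conf_at e t) B ->
  exists n, forall t', n <= t' -> undelivered (conf_at e t') B = mset0.
Proof.
move=> ex fair; move sE : (size (undelivered (conf_at e t) B)) => s.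
elim/ltn_ind: s t sE => s IH t sE q.
have [[t' tt' lt]|const] := pselect (exists2 t', t <= t' &
    size (undelivered (conf_at e t') B) < s).
  exact: (IH _ lt t' erefl (exec_quiet ex tt' q)).
have {}const t' : t <= t' -> undelivered (conf_at e t') B = undelivered (conf_at e t) B.
  move=> tt'; have h := exec_mail_le ex tt' q; apply/eqP; rewrite -h eqn_leq h sE leqNgt.
  by apply/negP => lt; apply: const; exists t'.
have nodeliv ev : is_control_delivery ev -> control_recipient ev = B ->
    ~ forall t', t <= t' -> enabled (conf_at e t') ev.
  move=> c rB /(fair t ev c)[t' tt' /(exec_event ex) st].
  by have := control_delivery_mail c st; rewrite rB !const ?leqW // ltnn.
exists t => t' tt'; rewrite const //.
case: (mset_0Vmem (undelivered (conf_at e t) B)) => // -[m mB]; exfalso.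
(* Info messages come first: their absence is what makes Release messages deliverable. *)
have noinfo y z A : InfoMsg y z A \notin undelivered (conf_at e t) B.
  apply/negP => yzB; have [[_]] := wf_msg (inv_wf (exec_inv t ex)) yzB.
  case: z yzB => z C D yzB /= DB CA _; rewrite DB CA in yzB.
  apply: (nodeliv (EvInfo y z A B)) => // u tu.
  have [Phi uB] := quiet_idle (exec_quiet ex tu q).
  rewrite -(const u tu) in yzB; case: (conf_at e u) uB yzB => al mu rho chi /= uB yzB.
  by eexists; apply: step_info uB yzB.
case: m mB => [x R|y z A|x n] xB; [|by have := noinfo y z A; rewrite xB|].
  by have := quiet_app x R q; rewrite xB.
have [/= xt _] := wf_msg (inv_wf (exec_inv t ex)) xB.
case: x xt xB => x A C /= -> {C} xB.
apply: (nodeliv (EvRelease x A B)) => // u tu.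
have uq := exec_quiet ex tu q; have [Phi uB] := quiet_idle uq.
rewrite -(const u tu) in xB.
have [m rm] := derives_recv_ex Phi (Refob x A B).
(* The guard of Release is met: with neither application nor Info messages in the mailbox nothing is
   in flight along the refob, and [life_release] equates the counts. *)
have nm : n = m.
  have ins : inside (conf_at e u) (Refob x A B).
    by rewrite /inside (exec_release_owner ex xB) (quiet_dom uq).
  have := @life_release _ (inv_life (exec_inv u ex)) (Refob x A B) n m ins xB.
  rewrite /recv /= (knE uB) => -> //; rewrite -[RHS]addn0; congr (_ + _).
  apply/eqP; rewrite -leqn0 leqNgt; apply/mset_has_count => -[[y R|y z D|//] yB _].
    by have := quiet_app y R uq; rewrite yB.
  by have := noinfo y z D; rewrite -(const u tu) yB.
rewrite -nm in rm; case: (conf_at e u) uB xB => al mu rho chi /= uB xB.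
by eexists; apply: step_release uB xB rm.
Qed.

(** * The last snapshot of a quiet actor *)

Definition call_at e B t : Prop :=
  exists2 ev, event_at e t = Some ev & calls_for_snapshot B ev.

Lemma no_call_back e B u v Psi : is_execution e -> u <= v ->
  (forall w, u <= w -> ~ call_at e B w) ->
  (internal (conf_at e v)).[? B] = Some (Idle Psi) ->
  exists2 Phi, (internal (conf_at e u)).[? B] = Some (Idle Phi) & compacted Phi Psi.
Proof.
move=> ex uv nc; elim: v uv Psi => [|v IH].
  by rewrite leqn0 => /eqP-> Psi h; exists Psi; last exact: compacted_refl.
rewrite leq_eqVlt ltnS => /predU1P[-> Psi h|uv Psi h].
  by exists Psi; last exact: compacted_refl.
have [Xi vXi cXi] : exists2 Xi, (internal (conf_at e v)).[? B] = Some (Idle Xi)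
    & compacted Xi Psi.
  case: (exec_step v ex) => [[ev ee st]|ev]; last first.
    by exists Psi; [rewrite -ev | exact: compacted_refl].
  by apply: (idle_step_back st) h => c; apply: (nc v uv); exists ev.
have [Phi uPhi cPhi] := IH uv Xi vXi.
by exists Phi => //; apply: compacted_trans cPhi cXi.
Qed.

(** Calls are bounded in time, since a quiet actor performs no Idle and an empty mailbox allows no
    delivery. There is at least one: otherwise [no_call_back] would make the actor idle in the
    initial configuration, whose only internal actor is busy. *)
Lemma last_call e t B : is_execution e -> eventually_delivers_control e ->
  quiet (conf_at e t) B ->
  exists2 s, call_at e B s & forall u, s < u -> ~ call_at e B u.
Proof.
move=> ex fair q; have [n empty] := mail_empties ex fair q.
have bound u : call_at e B u -> u <= maxn t n.
  case=> ev ee c; rewrite leqNgt; apply/negP; rewrite gtn_max => /andP[tu nu].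
  have [Phi uB] := quiet_idle (exec_quiet ex (ltnW tu) q).
  have mB := empty u (ltnW nu); have st := exec_event ex ee.
  move: uB mB c; case: {ee} st => //= [al mu rho chi Psi A alA|al mu rho chi Psi y z A C _ yC
    |al mu rho chi Psi x i A C _ xC _].
  - by move=> alB _ AB; rewrite -AB alA in alB.
  - by move=> _ mB CB; rewrite CB mB in_mset0 in yC.
  - by move=> _ mB CB; rewrite CB mB in_mset0 in xC.
have some : exists u, `[< call_at e B u >].
  apply: contrapT => none; have [Phi tB] := quiet_idle q.
  have [|Psi] := no_call_back ex (leq0n t) _ tB.
    by move=> w _ cw; apply: none; exists w; apply/asboolP.
  case: ex => -[A [E [x [y [_ _ ->]]]]] _; rewrite fnd_set fnd_fmap0.
  by case: eqP.
have boundb u : `[< call_at e B u >] -> u <= maxn t n by move/asboolP/bound.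
case: (ex_maxnP some boundb) => s /asboolP cs max; exists s => // u su /asboolP/max.
by rewrite leqNgt su.
Qed.

(** This is the snapshot answering the last call; afterwards only Compaction alters the knowledge of
    the actor. Snapshot and time form one pair so that a single choice selects both. *)
Lemma final_snapshot e t B : is_execution e -> eventually_delivers_control e ->
  eventually_snapshots e -> quiet (conf_at e t) B ->
  exists p : knowledge * nat, event_at e p.2 = Some (EvSnapshot B p.1) /\
    forall v, p.2 <= v ->
      exists2 Psi, (internal (conf_at e v)).[? B] = Some (Idle Psi) & compacted p.1 Psi.
Proof.
move=> ex fair snap q; have [s [ev es cs] last] := last_call ex fair q.
have [u [Phi [su eu]]] := snap B s ev es cs.
have nc w : u <= w -> ~ call_at e B w by move=> uw; apply: last; apply: leq_trans su uw.
exists (Phi, u); split=> //= v uv.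
(* The snapshot may precede [t], and so may [v]; idleness at [v] is read back from [maxn v t], where
   the actor is quiet. *)
have [Xi vXi] := quiet_idle (exec_quiet ex (leq_maxr v t) q).
have [|Psi vPsi _] := no_call_back ex (leq_maxl v t) _ vXi.
  by move=> w vw; apply: nc; apply: leq_trans uv vw.
exists Psi => //; have [Phi' uPhi'] := no_call_back ex uv nc vPsi.
have := exec_event ex eu; move: uPhi'; case: (conf_at e u) => al mu rho chi /= alB st.
by inversion st as [| | | | | | | | |? ? ? ? ? ? alB'| | | |]; subst; rewrite alB in alB'; case: alB' => ->.
Qed.

(** * The finalized set of snapshots *)

Lemma fset_bound (S : {fset nat}) (g : nat -> nat) : exists n, {in S, forall B, g B <= n}.
Proof.
exists (\max_(B <- enum_fset S) g B) => B BS.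
exact: (@leq_bigmax_seq _ (enum_fset S) xpredT g B BS isT).
Qed.

Theorem theorem6p12 (e : execution) (exec_e : is_execution e)
    (deliv_e : eventually_delivers_control e)
    (snap_e : eventually_snapshots e) (A : actor) (t : nat)
    (term_A : terminated e t A) :
  exists Q : snapshots, [/\ taken_in e Q, finalized Q & A \in domf Q].
Proof.
(* All quiet actors are taken, so that by [quiet_owner] the set contains every owner of an activated
   refob to a member. *)
pose S := [fset B in domf (internal (conf_at e t)) | `[< quiet (conf_at e t) B >]].
have SP B : B \in S -> quiet (conf_at e t) B by rewrite !inE => /andP[_ /asboolP].
have inS B : quiet (conf_at e t) B -> B \in S.
  by move=> q; rewrite !inE (quiet_dom q); apply/asboolP.
have /choice[q qP] (B : nat) : exists p : knowledge * nat, B \in S ->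
    event_at e p.2 = Some (EvSnapshot B p.1) /\
    forall v, p.2 <= v -> exists2 Psi,
      (internal (conf_at e v)).[? B] = Some (Idle Psi) & compacted p.1 Psi.
  (* Outside [S] the chosen pair is a placeholder. *)
  case: (boolP (B \in S)) => BS; last by exists (fset0, 0).
  have [p pP] := final_snapshot exec_e deliv_e snap_e (SP B BS).
  by exists p.
have /choice[g gP] (B : nat) : exists n, B \in S ->
    forall v, n <= v -> undelivered (conf_at e v) B = mset0.
  case: (boolP (B \in S)) => BS; last by exists 0.
  have [n nP] := mail_empties exec_e deliv_e (SP B BS).
  by exists n.
have [n1 n1P] := fset_bound S (fun B => (q B).2); have [n2 n2P] := fset_bound S g.
(* By time [T] all snapshots in [Q] have been taken and all mailboxes of [S] are empty, so the
   snapshots can be compared within one configuration. *)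
pose T := maxn t (maxn n1 n2).
have tT : t <= T by apply: leq_maxl.
have mailT B : B \in S -> undelivered (conf_at e T) B = mset0.
  by move=> BS; apply: gP => //; rewrite !leq_max n2P // !orbT.
have qT B : B \in S -> exists2 Psi,
    (internal (conf_at e T)).[? B] = Some (Idle Psi) & compacted (q B).1 Psi.
  by move=> BS; case: (qP B BS) => _; apply; rewrite !leq_max n1P // orbT.
pose Q : snapshots := [fmap B : S => (q (fsval B)).1].
have QE B : Q.[? B] = if B \in S then Some (q B).1 else None.
  case: (boolP (B \in S)) => BS; last by rewrite not_fnd.
  by rewrite (in_fnd (BS : B \in domf Q)) ffunE.
have Qder f : Qderives Q f -> fact_holder f \in S /\ derives (q (fact_holder f)).1 f.
  by case=> Phi; rewrite QE; case: ifP => // hS [->].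
have derQ f : fact_holder f \in S -> derives (q (fact_holder f)).1 f -> Qderives Q f.
  by move=> hS d; exists (q (fact_holder f)).1; rewrite // QE hS.
exists Q; split.
- move=> B Phi; rewrite QE; case: ifP => // BS [<-].
  by exists (q B).2; case: (qP B BS).
- move=> x xQ chain; have xS : target x \in S := xQ.
  have [W L] := exec_inv T exec_e.
  have tq := exec_quiet exec_e tT (SP _ xS).
  have [Psi xPsi cPsi] := qT _ xS.
  (* Only the last link of the chain matters: [x] is its first refob or was created using the one
     before. *)
  have [made nrel] : (Qderives Q (Created x) \/ exists y, Qderives Q (CreatedUsing y x))
      /\ ~ Qderives Q (Released x).
    case: chain => n [c [_ [c0 r0] cn xn]]; case: n cn xn => [|n] cn xn.
      by rewrite -xn; split=> //; left.
    have [un rn] := cn n (ltnSn n); rewrite xn in un rn.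
    by split=> //; right; exists (c n).
  have nr : Released x \notin (q (target x)).1.
    by apply/negP => r; apply: nrel; apply: derQ => //; apply: derives_mem.
  have usingT y z : owner y \in S -> CreatedUsing y z \in (q (owner y)).1 ->
      holds (internal (conf_at e T)) (CreatedUsing y z).
    move=> yS; have [Xi yXi cXi] := qT _ yS.
    by rewrite /holds /= (knE yXi) (compacted_mem cXi).
  (* The record of the creation survives until [T]: a [CreatedUsing] fact is never compacted, and
     [Created x] only if the snapshot records a release of [x]. [Created x] may also be derived from
     a [CreatedUsing] fact at the target itself. *)
  have born : 0 < intro (conf_at e T) x \/
      exists u, holds (internal (conf_at e T)) (CreatedUsing u x).
    case: made => [/Qder[_ /= d]|[y /Qder[/= yS /derives_using]]].
      case: (derives_createdE d) => [cx|[y yx]].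
        left; rewrite /intro addn_gt0; apply/orP; right; rewrite lt0b /holds /= (knE xPsi) /=.
        rewrite -(compacted_mem cPsi) // => z zr; split=> // -[zx].
        by rewrite -zx (negPf nr) in zr.
      rewrite (compacted_mem cPsi) // in yx; right; exists y.
      by rewrite /holds (wf_owner W xPsi yx) (knE xPsi).
    by move=> yx; right; exists y; apply: usingT.
  (* So [x] is in some stage; the exception would make its quiet target a receptionist. *)
  case: (life_live L (quiet_dom tq) born) => [|/andP[_]]; last first.
    by rewrite (negPf (quiet_receptionist tq)).
  rewrite /stage (quiet_pend W tq) /relm mailT // enum_mset0 add0n addn0 /= addn_gt0 !lt0b.
  (* A release recorded at [T] would already be in the snapshot, since compaction only removes
     facts. *)
  case/orP=> [act|rel]; last first.
    have [/fsubsetP sub _] := cPsi; case/negP: nr; apply: sub.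
    by move: rel; rewrite /holds /= (knE xPsi).
  (* Membership in [S] is decided at time [t], so the activation is carried back from [T]. *)
  have actt := exec_activated exec_e tT (SP _ xS) act.
  have oS : owner x \in S by apply: inS; apply: quiet_owner actt; apply: SP.
  have [Xi oXi cXi] := qT _ oS.
  split=> //.
  have [n dn] := derives_sent_ex (q (owner x)).1 x.
  have [m dm] := derives_recv_ex (q (target x)).1 x.
  have sn : sent (conf_at e T) x n.
    rewrite /sent (knE oXi); apply: derives_sent_eq dn => i.
    by apply: (compacted_mem cXi).
  (* The receive count of [x] cannot have been compacted, as the snapshot of the target records no
     release of [x]. *)
  have rm : recv (conf_at e T) x m.
    rewrite /recv (knE xPsi); apply: derives_recv_eq dm => i.
    apply: (compacted_mem cPsi) => z zr; split=> // j [zx _].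
    by rewrite -zx (negPf nr) in zr.
  have ins : inside (conf_at e T) x by rewrite /inside (domf_some oXi) (quiet_dom tq).
  have nm := life_sent L ins act sn rm.
  (* The mailbox of the target is empty, so nothing is in flight and the counts agree. *)
  have {}nm : n = m by rewrite nm /infl mailT // enum_mset0 addn0.
  exists n; split; apply: derQ => //=; last by rewrite nm.
  apply: derives_mem; rewrite (compacted_mem cXi) //.
  by move: act; rewrite /holds /= (knE oXi).
- exact: (inS _ (terminated_quiet term_A)).
Qed.
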